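(* There is an absolute constant $C>0$ such that the following holds. Let $\mathbf x_1,\dots,\mathbf x_n\in\mathbb R^d$, let $\ell_1,\dots,\ell_n:\mathbb R\to\mathbb R$ be convex, twice differentiable and smooth, let $\lambda>0$, $0<k\le n$, and let $m$ be a positive integer. Let $$\mathcal L(\mathbf w)=\frac1n\sum_{i=1}^n\ell_i(\mathbf w^\top\mathbf x_i)+\frac\lambda2\|\mathbf w\|^2,\qquad \mathbf w^*=\operatorname{argmin}_{\mathbf w}\mathcal L(\mathbf w),$$ and suppose the Hessian of $\mathcal L$ is $L$-Lipschitz: $\|\nabla^2\mathcal L(\mathbf u)-\nabla^2\mathcal L(\mathbf v)\|\le L\|\mathbf u-\mathbf v\|$ for all $\mathbf u,\mathbf v\in\mathbb R^d$. Let $\widehat{\mathcal L}_1,\dots,\widehat{\mathcal L}_m$ be i.i.d. copies of the random function $$\widehat{\mathcal L}(\mathbf w)=\frac1k\sum_{i=1}^n b_i\,\ell_i(\mathbf w^\top\mathbf x_i)+\frac\lambda2\|\mathbf w\|^2,\qquad b_1,\dots,b_n\ \text{independent } \mathrm{Bernoulli}(k/n).$$ Fix $\mathbf w\in\mathbb R^d$ and define $a_t=\det\big(\nabla^2\widehat{\mathcal L}_t(\mathbf w)\big)$, $\widehat{\mathbf p}_t=\nabla^{-2}\widehat{\mathcal L}_t(\mathbf w)\,\nabla\mathcal L(\mathbf w)$ and $$\mu=\frac1d\max_i\ \ell_i''(\mathbf w^\top\mathbf x_i)\,\|\mathbf x_i\|^2_{\nabla^{-2}\mathcal L(\mathbf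 w)},\qquad \widetilde{\mathbf w}=\mathbf w-\frac{\sum_{t=1}^m a_t\,\widehat{\mathbf p}_t}{\sum_{t=1}^m a_t}.$$ Let $\kappa$ and $\lambda_{\min}$ be the condition number and the smallest eigenvalue of $\nabla^2\mathcal L(\mathbf w)$. For any $\delta,\eta\in(0,1)$, if $k\ge C\eta^{-2}\mu d^2\log^3\frac d\delta$, then with probability at least $1-\delta$, $$\|\widetilde{\mathbf w}-\mathbf w^*\|\ \le\ \max\Big\{\frac{\eta}{\sqrt m}\sqrt\kappa\,\|\mathbf w-\mathbf w^*\|,\ \ \frac{2L}{\lambda_{\min}}\,\|\mathbf w-\mathbf w^*\|^2\Big\}.$$
   Context: $\nabla f$ and $\nabla^2 f$ denote the gradient and Hessian of $f$, and $\nabla^{-2}f(\mathbf w)=(\nabla^2 f(\mathbf w))^{-1}$. $\|\cdot\|$ is the Euclidean norm of a vector and the spectral norm of a matrix; for a positive definite matrix $\mathbf M$, $\|\mathbf v\|_{\mathbf M}=\sqrt{\mathbf v^\top\mathbf M\mathbf v}$. Explicitly, $\nabla^2\mathcal L(\mathbf w)=\frac1n\sum_i\ell_i''(\mathbf w^\top\mathbf x_i)\mathbf x_i\mathbf x_i^\top+\lambda\mathbf I$ and $\nabla^2\widehat{\mathcal L}(\mathbf w)=\frac1k\sum_i b_i\ell_i''(\mathbf w^\top\mathbf x_i)\mathbf x_i\mathbf x_i^\top+\lambda\mathbf I$. ''Smooth'' refers to the usual optimization notion (Lipschitz derivative). The function $\mathcal L$ is strongly convex, so $\mathbf w^*$ is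 its unique minimizer.
   Formalization: The formal theorem also assumes d/δ ≥ 2, which excludes only d = 1 with δ > 1/2; there log(d/δ) tends to 0 as δ → 1, the condition on k becomes vacuous, and the claim as stated fails for every C. *)

(* Defs.v *)
From HB Require Import structures.
From mathcomp Require Import all_boot all_order all_algebra.
From mathcomp Require Import all_classical all_reals all_analysis.

Set Implicit Arguments.
Unset Strict Implicit.
Unset Printing Implicit Defensive.
Import Order.TTheory GRing.Theory Num.Theory.
Import numFieldNormedType.Exports.
Local Open Scope ring_scope.
Local Open Scope classical_set_scope.

Section LinearAlgebra.
Context {R : realType} {d : nat}.
Implicit Types (u v : 'cV[R]_d) (A M : 'M[R]_d).

Definition dotv u v : R := (u^T *m v) 0 0.

(* The library's norm `|v| on matrices is the sup norm, hence this one. *)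
Definition l2norm v : R := Num.sqrt (dotv v v).

Definition wnorm M v : R := Num.sqrt ((v^T *m M *m v) 0 0).

Definition spectral_norm A : R :=
  sup [set l2norm (A *m v) | v in [set v | l2norm v <= 1]].

Definition condition_number A : R :=
  spectral_norm A * spectral_norm (invmx A).

(* The infimum is a minimum as soon as A has a real eigenvalue, in particular
   when A is symmetric and 0 < d. *)
Definition lambda_min A : R := inf [set a | eigenvalue A a].

End LinearAlgebra.

Section Calculus.
Context {R : realType} {d : nat}.
Implicit Types (f : 'cV[R]_d -> R) (w : 'cV[R]_d).

Definition gradient f w : 'cV[R]_d := \col_i 'D_(delta_mx i 0) f w.

Definition hessian f w : 'M[R]_d :=
  \matrix_(i, j) 'D_(delta_mx j 0) (fun u => 'D_(delta_mx i 0) f u) w.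

End Calculus.

Section Losses.
Context {R : realType} {n d : nat}.
Variables (x : 'I_n -> 'cV[R]_d) (ell : 'I_n -> R -> R) (lambda : R).

Definition loss (w : 'cV[R]_d) : R :=
  n%:R^-1 * (\sum_(i < n) ell i (dotv w (x i)))
  + lambda / 2 * l2norm w ^+ 2.

(* k is the expected sample size: a positive real, not necessarily an
   integer. *)
Definition subsampled_loss (k : R) (b : 'I_n -> bool) (w : 'cV[R]_d) : R :=
  k^-1 * (\sum_(i < n) (b i)%:R * ell i (dotv w (x i)))
  + lambda / 2 * l2norm w ^+ 2.

End Losses.

Section Regularity.
Context {R : realType}.

Definition twice_derivable (f : R -> R) : Prop :=
  forall z, derivable f z 1 /\ derivable (derive1 f) z 1.

Definition smooth (f : R -> R) : Prop :=
  exists beta : R, beta.-lipschitz (derive1 f).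

End Regularity.

Definition mutually_independent (R : realType) (dT dT' : measure_display)
    (T : measurableType dT) (T' : measurableType dT') (P : probability T R)
    (I : finType) (X : I -> {RV P >-> T'}) : Prop :=
  forall (J : {set I}) (A : I -> set T'), (forall i, measurable (A i)) ->
    P (\bigcap_(i in [set` J]) (X i @^-1` A i))
    = (\prod_(i in J) P (X i @^-1` A i))%E.

(* Main.v *)
(* Whiten by an S with S H S^T = I: the subsampled Hessians become
   Z_t = I + sum_i c_i v_i v_i^T with independent centred c_i. Since det and
   the cofactors are affine in each rank-one update, E det Z_t = 1 and
   E adj Z_t = I, so the weighted errors Y_t = det Z_t (Z_t^-1 - I) q are centred.
   Let G_t be the Euclidean norm of the pair (tr (Z_t - I), Z_t - I). Because
   the eigenvalues of Z_t are nonnegative, |Y_t| <= e |q| G_t e^{G_t} and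
   1 - det Z_t <= 3 G_t hold without any lower bound on Z_t; hence no matrix
   concentration is needed, only Pinelis' exponential inequality for sums of
   independent vectors, applied to G_t with variance of order mu d^2 / k.
   Moments of order p ~ log (d / delta) of sum_t Y_t (symmetrization) and an
   exponential Markov bound for the mean of 1 - det Z_t give
   |pt - P|_H <= alpha |P|_H with alpha = eta / (2 sqrt m) with probability at
   least 1 - delta, where P is the exact and pt the averaged Newton direction.
   Comparing the quadratic model at pt with its value at (w - wstar) / (1 - alpha^2)
   and using |grad L(w) - H (w - wstar)| <= L/2 |w - wstar|^2 concludes. *)
Require Import Defs.
From HB Require Import structures.
From mathcomp Require Import all_boot all_order all_algebra.
From mathcomp Require Import complex ring lra.
From mathcomp Require Import all_classical all_reals all_analysis.

Set Implicit Arguments.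
Unset Strict Implicit.
Unset Printing Implicit Defensive.
Import Order.TTheory GRing.Theory Num.Theory.
Import numFieldNormedType.Exports.
Local Open Scope ring_scope.
Local Open Scope classical_set_scope.

(** * Finite product probability spaces *)

(** Knowing only an exponential moment of G at scale r, one controls the moments of G e^G only up to
    order about 1/r. So the sum of the errors is bounded through a single moment of order p of its
    squared norm, with 2 p r at most 1, and not through an exponential bound. This is where the cube
    of the logarithm comes from: the p-th moment of one squared error costs (p r)^2, the moment
    inequality for sums costs another factor p, and p^3 r^2 must stay below a multiple of eta^2 with
    p of order log (d / delta). The denominator is treated differently. Convexity of exp bounds the
    mean of 1 - det over the m copies by the exponential moment of one copy, so no union over copies
    is taken and the sample size does not grow with m. The event depends on the m n random bits
    alone. All expectations are therefore finite sums, and measures enter only when the law of these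
    bits is identified. *)

Section FiniteProductExpectation.
Context {R : realType} {I A : finType} (pi : I -> A -> R).
Hypothesis pi_ge0 : forall i a, 0 <= pi i a.
Hypothesis pi_sum1 : forall i, \sum_a pi i a = 1.

Definition prodE (f : {ffun I -> A} -> R) : R :=
  \sum_(be : {ffun I -> A}) (\prod_i pi i (be i)) * f be.

Definition resample (be : {ffun I -> A}) (i : I) (a : A) : {ffun I -> A} :=
  [ffun j => if j == i then a else be j].

Lemma resample_eq be i a : resample be i a i = a.
Proof. by rewrite ffunE eqxx. Qed.

Lemma resample_neq be i a j : j != i -> resample be i a j = be j.
Proof. by rewrite ffunE => /negbTE->. Qed.

Lemma prodE_weight_ge0 be : 0 <= \prod_i pi i (be i).
Proof. exact: prodr_ge0. Qed.

Lemma prodE_weight_sum1 : \sum_(be : {ffun I -> A}) \prod_i pi i (be i) = 1.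
Proof.
by rewrite -(bigA_distr_bigA (fun i a => pi i a)) big1 // => i _; exact: pi_sum1.
Qed.

Lemma prodE_cst c : prodE (fun=> c) = c.
Proof. by rewrite /prodE -mulr_suml prodE_weight_sum1 mul1r. Qed.

Lemma prodE_le f g : (forall be, f be <= g be) -> prodE f <= prodE g.
Proof.
by move=> fg; apply: ler_sum => be _; rewrite ler_wpM2l // prodE_weight_ge0.
Qed.

Lemma prodED f g : prodE (fun be => f be + g be) = prodE f + prodE g.
Proof. by rewrite /prodE -big_split; apply: eq_bigr => be _; rewrite mulrDr. Qed.

Lemma prodEZ c f : prodE (fun be => c * f be) = c * prodE f.
Proof. by rewrite /prodE mulr_sumr; apply: eq_bigr => be _; rewrite mulrCA. Qed.

Lemma prodE_sum (J : finType) (f : J -> _ -> R) :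
  prodE (fun be => \sum_j f j be) = \sum_j prodE (f j).
Proof.
rewrite /prodE exchange_big; apply: eq_bigr => be _.
by rewrite mulr_sumr.
Qed.

(* (be, a) |-> (resample be i a, be i) is an involution preserving the weight. *)
Lemma prodE_resample i f :
  prodE f = prodE (fun be => \sum_a pi i a * f (resample be i a)).
Proof.
pose h (u : {ffun I -> A} * A) := (resample u.1 i u.2, u.1 i).
have hK : involutive h.
  move=> [be a]; rewrite /h /= resample_eq; congr pair; apply/ffunP => j.
  by rewrite !ffunE; case: eqVneq => // ->.
rewrite /prodE; under [RHS]eq_bigr do rewrite mulr_sumr.
rewrite pair_bigA /= (reindex_inj (inv_inj hK)) /=.
under [RHS]eq_bigr => u _.
  rewrite (_ : resample (resample u.1 i u.2) i (u.1 i) = u.1); last first.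
    by have := hK u; rewrite /h; case: u => be a [].
  rewrite mulrA (_ : _ * pi i (u.1 i) =
    (\prod_j pi j (u.1 j)) * pi i u.2); last first.
    rewrite [in LHS](bigD1 i) //= [in RHS](bigD1 i) //= resample_eq.
    rewrite (eq_bigr (fun j => pi j (u.1 j))); last first.
      by move=> j ji; rewrite resample_neq.
    by ring.
  over.
rewrite -(pair_bigA _ (fun (be : {ffun I -> A}) a => \prod_j pi j (be j) * pi i a * f be)) /=.
by apply: eq_bigr => be _; rewrite -mulr_suml -mulr_sumr pi_sum1 mulr1.
Qed.

Lemma prodE_coord i (f : A -> R) : prodE (fun be => f (be i)) = \sum_a pi i a * f a.
Proof.
rewrite (prodE_resample i) -[RHS]prodE_cst; apply: eq_bigr => be _; congr (_ * _).
by apply: eq_bigr => a _; rewrite resample_eq.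
Qed.

(* Integrate out one coordinate at a time: J is the set of coordinates of F
   that have not been replaced by their bound yet. *)
Lemma prodE_hybrid (F : {set I} -> {ffun I -> A} -> R) :
  (forall (J : {set I}) i be, i \notin J ->
    \sum_a pi i a * F (i |: J) (resample be i a)
    <= \sum_a pi i a * F J (resample be i a)) ->
  prodE (F [set: I]%SET) <= prodE (F finset.set0).
Proof.
move=> step.
have claim : forall J : {set I}, prodE (F J) <= prodE (F finset.set0).
  move=> J; have [N] := ubnP #|J|; elim: N J => // N IH J JN.
  have [->//|[i iJ]] := set_0Vmem J.
  have iJ' : i \notin (J :\ i)%SET by rewrite !inE eqxx.
  have JE : J = (i |: J :\ i)%SET by rewrite finset.setD1K.
  apply: (@le_trans _ _ (prodE (F (J :\ i)%SET))); last first.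
    by apply: IH; move: JN; rewrite (cardsD1 i) iJ.
  rewrite {1}JE; move: (J :\ i)%SET iJ' => J' iJ'.
  rewrite (prodE_resample i) [leRHS](prodE_resample i); apply: prodE_le => be.
  exact: step.
exact: claim.
Qed.

End FiniteProductExpectation.

(** * Convexity inequalities for powers, exp and cosh *)

Section Jensen.
Context {R : realType}.

(** The gap between a power and its tangent at c satisfies a recursion: the next gap is y times the
    current one plus a nonnegative multiple of (y - c)^2. *)
Lemma pow_tangent (y c : R) q : 0 <= y -> 0 <= c ->
  c ^+ q.+1 + q.+1%:R * c ^+ q * (y - c) <= y ^+ q.+1.
Proof.
move=> y0 c0; elim: q => [|q IH]; first by rewrite !expr1 expr0; lra.
rewrite -subr_ge0.
have -> : y ^+ q.+2 - (c ^+ q.+2 + q.+2%:R * c ^+ q.+1 * (y - c)) =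
  y * (y ^+ q.+1 - (c ^+ q.+1 + q.+1%:R * c ^+ q * (y - c)))
  + q.+1%:R * c ^+ q * (y - c) ^+ 2.
  by rewrite -[q.+2]addn1 -[q.+1]addn1 !natrD !exprD; ring.
apply: addr_ge0; first by rewrite mulr_ge0 // subr_ge0.
by rewrite mulr_ge0 ?sqr_ge0 // mulr_ge0 // exprn_ge0.
Qed.

Lemma pow_jensen (A : finType) (pi y : A -> R) q :
  (forall a, 0 <= pi a) -> \sum_a pi a = 1 -> (forall a, 0 <= y a) ->
  (\sum_a pi a * y a) ^+ q <= \sum_a pi a * y a ^+ q.
Proof.
move=> pi0 pi1 y0; case: q => [|q].
  by rewrite expr0; under eq_bigr do rewrite mulr1; rewrite pi1.
set c := \sum_a pi a * y a.
have c0 : 0 <= c by apply: sumr_ge0 => a _; rewrite mulr_ge0.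
apply: (@le_trans _ _ (\sum_a pi a * (c ^+ q.+1 + q.+1%:R * c ^+ q * (y a - c)))).
  under eq_bigr do rewrite mulrDr mulrCA mulrBr.
  rewrite big_split /= -mulr_suml pi1 mul1r -mulr_sumr sumrB -mulr_suml pi1 mul1r.
  by rewrite -/c subrr mulr0 addr0.
by apply: ler_sum => a _; rewrite ler_wpM2l // pow_tangent.
Qed.

Lemma pow_convex (lam x y : R) q : 0 <= lam <= 1 -> 0 <= x -> 0 <= y ->
  (lam * x + (1 - lam) * y) ^+ q <= lam * x ^+ q + (1 - lam) * y ^+ q.
Proof.
move=> /andP[l0 l1] x0 y0.
have := @pow_jensen bool (fun b => if b then lam else 1 - lam)
  (fun b => if b then x else y) q.
rewrite !big_bool /=; apply; first by case; rewrite ?subr_ge0.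
  by rewrite addrC subrK.
by case.
Qed.

(** Jensen for exp, from its tangent at c. Assuming only a lower bound c on the mean makes it
    directly usable in an exponential Markov bound. *)
Lemma exp_mean_ge (A : finType) (pi y : A -> R) (c : R) :
  (forall a, 0 <= pi a) -> \sum_a pi a = 1 -> c <= \sum_a pi a * y a ->
  expR c <= \sum_a pi a * expR (y a).
Proof.
move=> pi0 pi1 cy.
apply: (@le_trans _ _ (\sum_a pi a * (expR c * (1 + (y a - c))))).
  under eq_bigr do rewrite mulrCA mulrDr mulr1 mulrBr.
  rewrite -mulr_sumr big_split /= pi1 sumrB -mulr_suml pi1 mul1r.
  by rewrite ler_peMr ?expR_ge0 // lerDl subr_ge0.
apply: ler_sum => a _; rewrite ler_wpM2l // -[y a in leRHS](subrKC c) expRD.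
by rewrite ler_wpM2l ?expR_ge0 // expR_ge1Dx.
Qed.

End Jensen.

Section HyperbolicCosine.
Context {R : realType}.

Definition cosh (x : R) : R := (expR x + expR (- x)) / 2.
Definition sinh (x : R) : R := (expR x - expR (- x)) / 2.

Lemma coshN x : cosh (- x) = cosh x.
Proof. by rewrite /cosh opprK addrC. Qed.

Lemma coshD x y : cosh (x + y) = cosh x * cosh y + sinh x * sinh y.
Proof. by rewrite /cosh /sinh opprD !expRD; field. Qed.

Lemma coshB x y : cosh (x - y) = cosh x * cosh y - sinh x * sinh y.
Proof. by rewrite coshD coshN /sinh opprK; field. Qed.

Lemma cosh0 : cosh 0 = 1.
Proof. by rewrite /cosh oppr0 expR0; field. Qed.

Lemma cosh_gt0 x : 0 < cosh x.
Proof. by rewrite divr_gt0 // addr_gt0 // expR_gt0. Qed.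

Lemma cosh_ge1 x : 1 <= cosh x.
Proof.
by rewrite /cosh ler_pdivlMr // mul1r; have := expR_ge1Dx x; have := expR_ge1Dx (- x); lra.
Qed.

Lemma exp_le_cosh x : expR x <= 2 * cosh x.
Proof. by rewrite /cosh mulrC divfK ?lerDl ?expR_ge0 // pnatr_eq0. Qed.

Lemma sinh_le_cosh x : sinh x <= cosh x.
Proof. by rewrite ler_pM2r ?invr_gt0 // lerD2l ge0_cp // expR_ge0. Qed.

Lemma sinh_ge x : 0 <= x -> x <= sinh x.
Proof.
move=> x0; pose f (y : R) := sinh y - y.
have df (y : R) : is_derive y 1 f (cosh y - 1).
  rewrite /f /sinh; apply: is_derive_eq; rewrite /cosh /GRing.scale /=.
  by field.
have f0 : f 0 = 0 by rewrite /f /sinh oppr0; lra.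
rewrite -subr_ge0 -/(f x) -f0.
apply: (@ger0_derive1_ndecr _ f 0 x) => //.
- by move=> y _; rewrite derive1E derive_val subr_ge0 cosh_ge1.
- by apply: continuous_subspaceT => y; apply: differentiable_continuous; exact/derivable1_diffP.
Qed.

(* cosh o sqrt has nonnegative Taylor coefficients, hence it is convex. *)
Lemma cosh_sqrt_convex (lam a b r : R) : 0 <= lam <= 1 ->
  r ^+ 2 = lam * a ^+ 2 + (1 - lam) * b ^+ 2 ->
  cosh r <= lam * cosh a + (1 - lam) * cosh b.
Proof.
move=> lam01 rE.
pose u (x : R) n := (series (exp_coeff x) n + series (exp_coeff (- x)) n) / 2.
have ucvg x : u x @ \oo --> cosh x.
  by apply: cvgMl; apply: cvgD; rewrite /expR; exact: is_cvg_series_exp_coeff.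
have uE x n : u x n = \sum_(0 <= k < n) ((x ^+ 2) ^+ k./2 *+ ~~ odd k) / k`!%:R.
  rewrite /u /series /= -big_split /= mulr_suml; apply: eq_bigr => k _.
  rewrite /exp_coeff /= -mulrDl mulrAC; congr (_ / _).
  rewrite exprNn -exprM mul2n.
  case: (boolP (odd k)) (odd_double_half k) => ok /= kE; rewrite -signr_odd.
    by rewrite ok expr1 mulN1r subrr mul0r mulr0n.
  by move: kE; rewrite (negbTE ok) add0n => ->; rewrite expr0 mul1r mulr1n; field.
have cvgR : (fun n => lam * u a n + (1 - lam) * u b n) @ \oo -->
    lam * cosh a + (1 - lam) * cosh b.
  by apply: cvgD; apply: cvgMr; exact: ucvg.
apply: (ler_cvg_to (ucvg r) cvgR); near=> n.
rewrite !uE !mulr_sumr -big_split /=; apply: ler_sum => k _.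
rewrite !mulrA -mulrDl ler_wpM2r ?invr_ge0 //; case: (odd k) => /=.
  by rewrite !mulr0n !mulr0 addr0.
by rewrite !mulr1n rE pow_convex ?sqr_ge0.
Unshelve. all: by end_near.
Qed.

(** Since e^y (1 - y) <= 1, it suffices that (1 + y + 2 y^2) (1 - y) = 1 + y^2 (1 - 2 y) is at least
    1, which explains the range of y. With the linear term gone, a summand contributes its variance
    to the exponent. *)
Lemma exp_sub_le (y : R) : 0 <= y <= 1 / 2 -> expR y - y <= 1 + 2 * y ^+ 2.
Proof.
move=> /andP[y0 y1].
have e : expR y * (1 - y) <= 1.
  rewrite -[leRHS](expR0) -(subrr y) expRD ler_wpM2l ?expR_ge0 //.
  exact: expR_ge1Dx.
have : expR y * (1 - y) <= (1 + y + 2 * y ^+ 2) * (1 - y).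
  by apply: le_trans e _; nra.
by rewrite ler_pM2r; lra.
Qed.

End HyperbolicCosine.
(** * Vector concentration *)

Section EuclideanFunctions.
Context {R : realType} {J : finType}.
Implicit Types u v : J -> R.

(** Vectors are functions on an arbitrary finite type because the concentration inequality will be
    applied to a trace together with the entries of a matrix, indexed by a sum type. *)
Definition dotf u v : R := \sum_j u j * v j.
Definition normf u : R := Num.sqrt (dotf u u).

Lemma dotf_ge0 u : 0 <= dotf u u.
Proof. by apply: sumr_ge0 => j _; rewrite -expr2 sqr_ge0. Qed.

Lemma normf_ge0 u : 0 <= normf u. Proof. exact: sqrtr_ge0. Qed.

Lemma sqr_normf u : normf u ^+ 2 = dotf u u.
Proof. by rewrite sqr_sqrtr // dotf_ge0. Qed.

Lemma dotfC u v : dotf u v = dotf v u.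
Proof. by apply: eq_bigr => j _; rewrite mulrC. Qed.

Lemma dotfDr u v w : dotf u (v \+ w) = dotf u v + dotf u w.
Proof. by rewrite /dotf -big_split; apply: eq_bigr => j _; rewrite /= mulrDr. Qed.

Lemma dotf_sumr (A : finType) (c : A -> R) (X : A -> J -> R) u :
  dotf u (fun j => \sum_a c a * X a j) = \sum_a c a * dotf u (X a).
Proof.
rewrite /dotf; under eq_bigr do rewrite mulr_sumr.
rewrite exchange_big; apply: eq_bigr => a _.
by rewrite mulr_sumr; apply: eq_bigr => j _; rewrite mulrCA.
Qed.

Lemma dotfDD u v : dotf (u \+ v) (u \+ v) = dotf u u + 2 * dotf u v + dotf v v.
Proof. by rewrite dotfDr ![dotf (_ \+ _) _]dotfC !dotfDr [dotf v u]dotfC; ring. Qed.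

Lemma dotfBB u v : dotf (u \- v) (u \- v) = dotf u u - 2 * dotf u v + dotf v v.
Proof.
rewrite /dotf mulr_sumr -sumrB -big_split; apply: eq_bigr => j _ /=; ring.
Qed.

Lemma dotf_comb a b u v :
  dotf (fun j => a * u j - b * v j) (fun j => a * u j - b * v j) =
  a ^+ 2 * dotf u u - 2 * a * b * dotf u v + b ^+ 2 * dotf v v.
Proof.
rewrite /dotf !mulr_sumr -sumrB -big_split; apply: eq_bigr => j _ /=; ring.
Qed.

(** Cauchy-Schwarz, from the squared norm of |v|^2 u - (u.v) v; it carries a factor |v|^2, so v = 0
    is treated apart. *)
Lemma dotf_sqr_le u v : dotf u v ^+ 2 <= dotf u u * dotf v v.
Proof.
have := dotf_ge0 (fun j => dotf v v * u j - dotf u v * v j).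
set X := dotf _ _ => X0.
have XE : X = dotf v v * (dotf u u * dotf v v - dotf u v ^+ 2).
  by rewrite /X dotf_comb; ring.
have := dotf_ge0 v; rewrite le_eqVlt => /predU1P[v0|v0]; last first.
  by move: X0; rewrite XE pmulr_rge0 // subr_ge0.
have vj j : v j = 0.
  move/esym/eqP: v0; rewrite /dotf psumr_eq0 => [/allP/(_ j)|i _].
    by rewrite mem_index_enum mulf_eq0 orbb => /(_ isT)/eqP.
  by rewrite -expr2 sqr_ge0.
rewrite -v0 mulr0 (_ : dotf u v = 0) ?expr0n //.
by rewrite /dotf big1 // => j _; rewrite vj mulr0.
Qed.

Lemma dotf_norm_le u v : `|dotf u v| <= normf u * normf v.
Proof.
rewrite -ler_sqr ?nnegrE ?mulr_ge0 ?normf_ge0 //.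
by rewrite real_normK ?num_real // exprMn !sqr_normf dotf_sqr_le.
Qed.

End EuclideanFunctions.

Section Pinelis.
Context {R : realType} {J : finType}.

(* With sg the cosine of the angle between S and X, |S + X|^2 is the mean of
   (|S| + |X|)^2 and (|S| - |X|)^2 with weights (1 + sg) / 2 and (1 - sg) / 2. *)
Lemma cosh_norm_add (S : J -> R) : exists g : R, forall X : J -> R,
  cosh (normf (S \+ X)) <=
    cosh (normf S) * (expR (normf X) - normf X) + g * dotf S X.
Proof.
set s := normf S; have s0 : 0 <= s := normf_ge0 S.
(* This coefficient depends on S alone: averaging over a centred X removes the whole linear term.
   For s = 0 the scalar product it multiplies is zero. *)
exists (sinh s / s) => X; set x := normf X; have x0 : 0 <= x := normf_ge0 X.
have chx : cosh x + (sinh x - x) = expR x - x by rewrite /cosh /sinh; field.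
have dsx : `|dotf S X| <= s * x := dotf_norm_le S X.
have shs : 0 <= sinh s by apply: le_trans (sinh_ge s0).
have shx : 0 <= sinh x - x by rewrite subr_ge0 sinh_ge.
have nE : normf (S \+ X) ^+ 2 = s ^+ 2 + 2 * dotf S X + x ^+ 2.
  by rewrite !sqr_normf dotfDD.
have [sx0|sx0] := eqVneq (s * x) 0.
  have dot0 : dotf S X = 0 by apply/eqP; rewrite -normr_le0 -sx0.
  rewrite dot0 mulr0 addr0; move: nE; rewrite dot0 mulr0 addr0 => nE.
  have -> : cosh (normf (S \+ X)) = cosh s * cosh x.
    move/eqP: sx0; rewrite mulf_eq0 => /orP[]/eqP h0; move: nE; rewrite h0.
      rewrite expr0n add0r cosh0 mul1r => /eqP.
      by rewrite eqrXn2 ?normf_ge0 // => /eqP->.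
    rewrite expr0n addr0 cosh0 mulr1 => /eqP.
    by rewrite eqrXn2 ?normf_ge0 // => /eqP->.
  by rewrite -chx ler_wpM2l ?(ltW (cosh_gt0 _)) // lerDl.
have sx_gt0 : 0 < s * x by rewrite lt_def sx0 mulr_ge0.
have s_gt0 : s != 0 by move: sx0; rewrite mulf_eq0 negb_or => /andP[].
pose sg := dotf S X / (s * x).
have sgE : dotf S X = sg * (s * x) by rewrite /sg divfK.
have sg1 : `|sg| <= 1 by rewrite normrM normfV (gtr0_norm sx_gt0) ler_pdivrMr // mul1r.
have /andP[sgl sgu] : - 1 <= sg <= 1 by rewrite -ler_norml.
have := @cosh_sqrt_convex R ((1 + sg) / 2) (s + x) (s - x) (normf (S \+ X)).
rewrite nE sgE coshD coshB => /(_ _ _)/le_trans; apply; [lra|by field|].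
have -> : (1 + sg) / 2 * (cosh s * cosh x + sinh s * sinh x) +
  (1 - (1 + sg) / 2) * (cosh s * cosh x - sinh s * sinh x) =
  cosh s * cosh x + sg * (sinh s * (sinh x - x)) + sg * sinh s * x by field.
rewrite -chx (_ : sinh s / s * (sg * (s * x)) = sg * sinh s * x); last by field.
rewrite lerD2r [leRHS]mulrDr lerD2l.
apply: (@le_trans _ _ (1 * (sinh s * (sinh x - x)))).
  by rewrite ler_wpM2r // mulr_ge0.
by rewrite mul1r ler_wpM2r // sinh_le_cosh.
Qed.

(** Adding one centred summand multiplies the mean of the cosh of the norm by at most 1 + 2
    E|X_i|^2, hence by the exponential of 2 E|X_i|^2; the bound 1/2 on the summands is the range of
    [exp_sub_le]. The dimension does not enter. *)
Lemma pinelis (I A : finType) (pi : I -> A -> R) (X : I -> A -> J -> R) :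
  (forall i a, 0 <= pi i a) -> (forall i, \sum_a pi i a = 1) ->
  (forall i j, \sum_a pi i a * X i a j = 0) ->
  (forall i a, normf (X i a) <= 1 / 2) ->
  prodE pi (fun be => cosh (normf (fun j => \sum_i X i (be i) j)))
  <= expR (2 * \sum_i \sum_a pi i a * normf (X i a) ^+ 2).
Proof.
move=> pi0 pi1 X0 Xle.
pose C i := expR (2 * \sum_a pi i a * normf (X i a) ^+ 2).
have C0 i : 0 <= C i := expR_ge0 _.
pose S (K : {set I}) (be : {ffun I -> A}) j := \sum_(i in K) X i (be i) j.
pose F K be := cosh (normf (S K be)) * \prod_(i | i \notin K) C i.
have -> : prodE pi (fun be => cosh (normf (fun j => \sum_i X i (be i) j))) =
    prodE pi (F [set: I]%SET).
  have C1 : \prod_(i | i \notin [set: I]%SET) C i = 1.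
    by rewrite big_pred0 // => i; rewrite finset.in_setT.
  apply: eq_bigr => be _; rewrite /F C1 mulr1.
  congr (_ * cosh (normf _)); apply/funext => j; rewrite /S.
  by apply: eq_bigl => i; rewrite finset.in_setT.
have -> : expR (2 * \sum_i \sum_a pi i a * normf (X i a) ^+ 2) =
    prodE pi (F finset.set0).
  rewrite -[LHS](prodE_cst pi1); apply: eq_bigr => be _; congr (_ * _).
  rewrite /F (_ : S _ _ = fun=> 0); last first.
    by apply/funext => j; rewrite /S big_pred0 // => i; rewrite inE.
  have -> : @normf R J (fun=> 0) = 0.
    by rewrite /normf /dotf big1 ?sqrtr0 // => j _; rewrite mul0r.
  rewrite cosh0 mul1r.
  rewrite mulr_sumr expR_sum; apply: eq_big => // i.
  by rewrite finset.in_set0.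
apply: prodE_hybrid => // K i be iK.
have Fr a : F (i |: K)%SET (resample be i a) =
    cosh (normf (S K be \+ X i a)) * \prod_(j | j \notin (i |: K)%SET) C j.
  congr (cosh (normf _) * _); apply/funext => j; rewrite /S big_setU1 //= addrC.
  rewrite resample_eq; congr (_ + _); apply: eq_bigr => l lK.
  by rewrite resample_neq //; apply: contraNneq iK => <-.
have Fr0 a : F K (resample be i a) =
    cosh (normf (S K be)) * (C i * \prod_(j | j \notin (i |: K)%SET) C j).
  congr (cosh (normf _) * _).
    apply/funext => j; rewrite /S; apply: eq_bigr => l lK.
    by rewrite resample_neq //; apply: contraNneq iK => <-.
  rewrite (bigD1 i) //=; congr (_ * _); apply: eq_bigl => l.
  by rewrite !inE negb_or andbC.
under eq_bigr do rewrite Fr mulrA.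
under [leRHS]eq_bigr do rewrite Fr0.
rewrite -!mulr_suml pi1 mul1r mulrA ler_wpM2r ?prodr_ge0 //.
have [g gP] := cosh_norm_add (S K be).
apply: (@le_trans _ _ (\sum_a pi i a * (cosh (normf (S K be)) *
    (1 + 2 * normf (X i a) ^+ 2) + g * dotf (S K be) (X i a)))).
  apply: ler_sum => a _; rewrite ler_wpM2l //.
  apply: le_trans (gP _) _; rewrite lerD2r ler_wpM2l ?(ltW (cosh_gt0 _)) //.
  by rewrite exp_sub_le // normf_ge0 Xle.
under eq_bigr do rewrite mulrDr.
rewrite big_split /=.
have -> : \sum_a pi i a * (g * dotf (S K be) (X i a)) = 0.
  under eq_bigr do rewrite mulrCA.
  rewrite -mulr_sumr -dotf_sumr (_ : dotf _ _ = 0) ?mulr0 //.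
  by rewrite /dotf big1 // => j _; rewrite X0 mulr0.
under eq_bigr do rewrite mulrCA.
rewrite -mulr_sumr addr0 ler_wpM2l ?(ltW (cosh_gt0 _)) //.
under eq_bigr do rewrite mulrDr mulr1 mulrCA.
by rewrite big_split /= pi1 -mulr_sumr; exact: expR_ge1Dx.
Qed.
End Pinelis.

(** * Moments of sums of independent vectors by symmetrization *)

Section Symmetrization.
Context {R : realType}.

(* U k and V k below are the even and odd parts of (A + t)^k; induction on k
   gives A V k <= k t U k. *)
Lemma two_point (A B t : R) q : 0 <= B -> `|t| <= A -> q%:R * t ^+ 2 <= A * B ->
  ((A + t) ^+ q + (A - t) ^+ q) / 2 <= (A + B) ^+ q.
Proof.
move=> B0; wlog t0 : t / 0 <= t => [hwlog|].
  move=> tA qt; have [/hwlog|/ltW t0] := leP 0 t; first exact.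
  have := hwlog (- t); rewrite oppr_ge0 normrN sqrrN opprK => /(_ t0 tA qt).
  by rewrite [_ ^+ q + _]addrC.
rewrite (ger0_norm t0) => tA.
have A0 : 0 <= A by apply: le_trans tA.
pose U k := ((A + t) ^+ k + (A - t) ^+ k) / 2.
pose V k := ((A + t) ^+ k - (A - t) ^+ k) / 2.
have US k : U k.+1 = A * U k + t * V k by rewrite /U /V !exprS; field.
have VS k : V k.+1 = A * V k + t * U k by rewrite /U /V !exprS; field.
have At0 : 0 <= A + t by rewrite addr_ge0.
have AB0 : 0 <= A - t by rewrite subr_ge0.
have U0 k : 0 <= U k by rewrite divr_ge0 // addr_ge0 // exprn_ge0.
have V0 k : 0 <= V k.
  by rewrite divr_ge0 // subr_ge0 lerXn2r ?nnegrE //; lra.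
have AV k : A * V k <= k%:R * t * U k.
  elim: k => [|k IH]; first by rewrite /V !expr0 subrr mul0r mulr0 !mul0r.
  rewrite VS mulrDr -natr1.
  have : A * (A * V k) <= A * (k%:R * t * U k) by rewrite ler_wpM2l.
  have : (k%:R + 1) * t * (A * U k) <= (k%:R + 1) * t * U k.+1.
    by rewrite ler_wpM2l ?mulr_ge0 ?addr_ge0 // US lerDl mulr_ge0.
  lra.
move=> qt; rewrite -/(U q).
have tV k : (k <= q)%N -> t * V k <= B * U k.
  move=> kq; have [A00|An0] := eqVneq A 0.
    have t00 : t = 0 by apply/eqP; rewrite eq_le t0 andbT -A00.
    by rewrite t00 mul0r mulr_ge0.
  have Ap : 0 < A by rewrite lt_def An0.
  rewrite -(ler_pM2l Ap).
  have h1 : t * (A * V k) <= t * (k%:R * t * U k) by rewrite ler_wpM2l.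
  have h2 : k%:R * t ^+ 2 * U k <= A * B * U k.
    rewrite ler_wpM2r //; apply: le_trans qt.
    by rewrite ler_wpM2r ?sqr_ge0 // ler_nat.
  lra.
have: forall k, (k <= q)%N -> U k <= (A + B) ^+ k.
  elim=> [_|k IH kq]; first by rewrite /U !expr0; lra.
  rewrite US exprS.
  have h1 := tV k (ltnW kq); have h2 := IH (ltnW kq).
  apply: (@le_trans _ _ ((A + B) * U k)); first by lra.
  by rewrite ler_wpM2l // addr_ge0.
exact.
Qed.

(* By Jensen X may be replaced by X - X' with X' an independent copy; averaging
   over its sign then leads to two_point. *)
Lemma symmetrization_step (J A : finType) (pi : A -> R) (X : A -> J -> R)
    (S : J -> R) (c : R) q :
  (forall a, 0 <= pi a) -> \sum_a pi a = 1 ->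
  (forall j, \sum_a pi a * X a j = 0) -> 0 <= c ->
  \sum_a pi a * (dotf (S \+ X a) (S \+ X a) + c) ^+ q <=
  \sum_a pi a *
    (dotf S S + c + 4 * (4 * q%:R + 1) * dotf (X a) (X a)) ^+ q.
Proof.
(* With D = X - X', the 1 in [kp] is the |D|^2 in the expansion of |S + D|^2 and 4 q is the price of
   the cross term in [two_point]. The outer 4 comes from |D|^2 <= 2 |X|^2 + 2 |X'|^2, followed by
   convexity with weights 1/2. *)
move=> pi0 pi1 X0 c0; set kp := 4 * q%:R + 1.
have kp0 : 0 <= kp by rewrite addr_ge0 // mulr_ge0.
pose sq u : R := @dotf R J u u.
have sq0 u : 0 <= sq u := dotf_ge0 u.
pose D a a' : J -> R := X a \- X a'.
have step1 a : (sq (S \+ X a) + c) ^+ q <=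
    \sum_a' pi a' * (sq (S \+ D a a') + c) ^+ q.
  apply: le_trans (pow_jensen q pi0 pi1 _); last by move=> a'; rewrite addr_ge0.
  have h a' : pi a' * (sq (S \+ D a a') + c) = pi a' * (sq (S \+ X a) + c)
      - 2 * (pi a' * dotf (S \+ X a) (X a')) + pi a' * sq (X a').
    have -> : sq (S \+ D a a') =
        sq (S \+ X a) - 2 * dotf (S \+ X a) (X a') + sq (X a').
      rewrite /sq -dotfBB; congr dotf; apply/funext => j /=; rewrite /D /=; ring.
    ring.
  under eq_bigr do rewrite h.
  rewrite big_split sumrB /= -mulr_suml pi1 mul1r -mulr_sumr -dotf_sumr.
  rewrite (_ : dotf _ _ = 0) ?mulr0 ?subr0; last first.
    by rewrite /dotf big1 // => j _; rewrite X0 mulr0.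
  have s0 : 0 <= \sum_a' pi a' * sq (X a').
    by apply: sumr_ge0 => a' _; rewrite mulr_ge0.
  rewrite lerXn2r ?nnegrE ?addr_ge0 //; last by rewrite lerDl.
apply: (@le_trans _ _ (\sum_a \sum_a' pi a * pi a' * (sq (S \+ D a a') + c) ^+ q)).
  apply: ler_sum => a _; under eq_bigr do rewrite -mulrA.
  by rewrite -mulr_sumr; apply: ler_wpM2l => //; exact: step1.
pose T := \sum_a \sum_a' pi a * pi a' * (sq (S \+ D a a') + c) ^+ q.
(* Exchanging the two independent copies changes the sign of D, so averaging over that sign is
   free. *)
have TE : T = \sum_a \sum_a' pi a * pi a' * (sq (S \- D a a') + c) ^+ q.
  rewrite /T exchange_big; apply: eq_bigr => a _; apply: eq_bigr => a' _.
  rewrite (mulrC (pi a')); congr (_ * (sq _ + _) ^+ _).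
  by apply/funext => j; rewrite /D /=; ring.
rewrite -/T.
pose f a := (sq S + c + 4 * kp * sq (X a)) ^+ q.
have two a a' : ((sq (S \+ D a a') + c) ^+ q + (sq (S \- D a a') + c) ^+ q) / 2
    <= (f a + f a') / 2.
  have y0 := sq0 (D a a').
  have cs : dotf S (D a a') ^+ 2 <= sq S * sq (D a a') := dotf_sqr_le _ _.
  set A0 := sq S + c + sq (D a a'); set t := 2 * dotf S (D a a').
  have -> : sq (S \+ D a a') + c = A0 + t by rewrite /sq dotfDD /A0 /t /sq; ring.
  have -> : sq (S \- D a a') + c = A0 - t by rewrite /sq dotfBB /A0 /t /sq; ring.
  have S0 := sq0 S.
  have A00 : 0 <= A0 by rewrite !addr_ge0.
  apply: (@le_trans _ _ ((A0 + 4 * q%:R * sq (D a a')) ^+ q)).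
    apply: two_point; first by rewrite !mulr_ge0.
      rewrite -ler_sqr ?nnegrE // real_normK ?num_real // /t.
      have := sqr_ge0 (sq S - sq (D a a')).
      have := mulr_ge0 c0 (addr_ge0 c0 (addr_ge0 S0 y0)).
      have := mulr_ge0 c0 (addr_ge0 S0 y0).
      by rewrite exprMn /A0; lra.
    (* Cauchy-Schwarz for t = 2 S.D, with |S|^2 at most A0; multiplied by q this is the hypothesis
       of [two_point] for B = 4 q |D|^2. *)
    have : t ^+ 2 <= A0 * (4 * sq (D a a')).
      by have := mulr_ge0 c0 y0; have := mulr_ge0 y0 y0; rewrite /t exprMn /A0; lra.
    move=> /(ler_wpM2l (ler0n R q))/le_trans; apply.
    by rewrite le_eqVlt; apply/orP; left; apply/eqP; ring.
  have Dle : sq (D a a') <= 2 * sq (X a) + 2 * sq (X a').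
    have := sq0 (X a \+ X a'); rewrite /sq dotfDD dotfBB; lra.
  have ff x : 0 <= sq S + c + 4 * kp * sq (X x).
    by rewrite addr_ge0 ?addr_ge0 // !mulr_ge0.
  apply: (@le_trans _ _ ((1 / 2 * (sq S + c + 4 * kp * sq (X a)) +
      (1 - 1 / 2) * (sq S + c + 4 * kp * sq (X a'))) ^+ q)).
    have p1 : 0 <= A0 + 4 * q%:R * sq (D a a') by rewrite addr_ge0 // !mulr_ge0.
    have le1 : A0 + 4 * q%:R * sq (D a a') <=
        1 / 2 * (sq S + c + 4 * kp * sq (X a)) +
        (1 - 1 / 2) * (sq S + c + 4 * kp * sq (X a')).
      rewrite -subr_ge0.
      have -> : 1 / 2 * (sq S + c + 4 * kp * sq (X a)) +
          (1 - 1 / 2) * (sq S + c + 4 * kp * sq (X a')) -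
          (A0 + 4 * q%:R * sq (D a a')) =
          kp * (2 * sq (X a) + 2 * sq (X a') - sq (D a a')).
        by rewrite /A0 /kp; field.
      by rewrite mulr_ge0 // subr_ge0.
    by apply: lerXn2r; rewrite ?nnegrE // (le_trans p1).
  apply: le_trans (pow_convex _ _ _ _) _ => //; first by lra.
  by rewrite /f; lra.
have -> : T = \sum_a \sum_a' pi a * pi a' *
    (((sq (S \+ D a a') + c) ^+ q + (sq (S \- D a a') + c) ^+ q) / 2).
  rewrite -[LHS](@mulfK _ 2) ?pnatr_eq0 // mulrDr mulr1 {2}TE /T -big_split /=.
  rewrite mulr_suml; apply: eq_bigr => a _; rewrite -big_split mulr_suml /=.
  by apply: eq_bigr => a' _; ring.
apply: (@le_trans _ _ (\sum_a \sum_a' pi a * pi a' * ((f a + f a') / 2))).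
  apply: ler_sum => a _; apply: ler_sum => a' _; rewrite ler_wpM2l ?mulr_ge0 //.
have fE a : \sum_a' pi a * pi a' * ((f a + f a') / 2) =
    pi a * f a / 2 + pi a * (\sum_a' pi a' * f a') / 2.
  rewrite (eq_bigr (fun a' => pi a' * (pi a * f a / 2) + pi a / 2 * (pi a' * f a'))).
    by rewrite big_split /= -mulr_suml pi1 -mulr_sumr; ring.
  by move=> a' _; ring.
under eq_bigr do rewrite fE.
rewrite big_split /= -!mulr_suml pi1 mul1r /f /sq.
by rewrite le_eqVlt; apply/orP; left; apply/eqP; field.
Qed.

(* A Marcinkiewicz-Zygmund inequality in a Euclidean space. *)
Lemma moment_sum_le (I J A : finType) (pi : I -> A -> R) (X : I -> A -> J -> R) q K :
  (forall i a, 0 <= pi i a) -> (forall i, \sum_a pi i a = 1) ->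
  (forall i j, \sum_a pi i a * X i a j = 0) -> (0 < #|I|)%N ->
  (forall i, \sum_a pi i a * dotf (X i a) (X i a) ^+ q <= K) ->
  prodE pi (fun be => dotf (fun j => \sum_i X i (be i) j)
    (fun j => \sum_i X i (be i) j) ^+ q)
  <= (4 * (4 * q%:R + 1) * #|I|%:R) ^+ q * K.
Proof.
move=> pi0 pi1 X0 I0 XK; set kp := 4 * (4 * q%:R + 1).
have kp0 : 0 <= kp by rewrite mulr_ge0 // addr_ge0 // mulr_ge0.
pose sq u : R := @dotf R J u u.
have sq0 u : 0 <= sq u := dotf_ge0 u.
pose S (L : {set I}) (be : {ffun I -> A}) j := \sum_(i in L) X i (be i) j.
pose c (L : {set I}) (be : {ffun I -> A}) :=
  \sum_(i | i \notin L) kp * sq (X i (be i)).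
have c0 L be : 0 <= c L be by apply: sumr_ge0 => i _; rewrite mulr_ge0.
pose F L be := (sq (S L be) + c L be) ^+ q.
have -> : prodE pi (fun be => dotf (fun j => \sum_i X i (be i) j)
    (fun j => \sum_i X i (be i) j) ^+ q) = prodE pi (F [set: I]%SET).
  apply: eq_bigr => be _; congr (_ * _ ^+ _).
  rewrite /c big_pred0 => [|i]; last by rewrite finset.in_setT.
  rewrite addr0 /sq; congr dotf; apply/funext => j; rewrite /S;
  by apply: eq_bigl => i; rewrite finset.in_setT.
have IR : 0 < #|I|%:R :> R by rewrite ltr0n.
apply: (@le_trans _ _ (prodE pi (F finset.set0))); last first.
  (* Once every vector is replaced by its squared norm, the power of a sum is bounded by Jensen with
     uniform weights, whence the factor #|I| inside the power. *)
  apply: (@le_trans _ _ (prodE pi (fun be => (kp * #|I|%:R) ^+ q *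
      (\sum_i #|I|%:R^-1 * sq (X i (be i)) ^+ q)))).
    apply: prodE_le => // be; rewrite /F.
    have -> : S finset.set0 be = fun=> 0.
      by apply/funext => j; rewrite /S big_pred0 // => i; rewrite finset.in_set0.
    rewrite [sq _]big1 ?add0r => [|j _]; last by rewrite mul0r.
    have -> : c finset.set0 be = kp * #|I|%:R * \sum_i #|I|%:R^-1 * sq (X i (be i)).
      rewrite -mulr_sumr mulrA mulfK ?gt_eqF // mulr_sumr.
      by apply: eq_bigl => i; rewrite finset.in_set0.
    rewrite exprMn ler_wpM2l ?exprn_ge0 ?mulr_ge0 //.
    apply: pow_jensen => //.
    by rewrite sumr_const -[_ *+ _]mulr_natr mulVf ?gt_eqF.
  rewrite prodEZ ler_wpM2l ?exprn_ge0 ?mulr_ge0 // prodE_sum.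
  apply: (@le_trans _ _ (\sum_(i : I) #|I|%:R^-1 * K)).
    apply: ler_sum => i _; rewrite prodEZ ler_wpM2l ?invr_ge0 //.
    by rewrite (prodE_coord pi1 i (fun a => sq (X i a) ^+ q)).
  by rewrite sumr_const -[_ *+ _]mulr_natl mulrA divff ?gt_eqF // mul1r.
apply: prodE_hybrid => // L i be iL.
have sumr_off (f : I -> A -> R) a (P : pred I) : ~~ P i ->
    \sum_(l | P l) f l (resample be i a l) = \sum_(l | P l) f l (be l).
  move=> Pi; apply: eq_bigr => l Pl; rewrite resample_neq //.
  by apply: contraNneq Pi => <-.
have Fr a : F (i |: L)%SET (resample be i a) =
    (sq (S L be \+ X i a) + c (i |: L)%SET be) ^+ q.
  congr ((sq _ + _) ^+ _).
    apply/funext => j; rewrite /S big_setU1 //= addrC resample_eq.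
    by rewrite (sumr_off (fun l a => X l a j)).
  rewrite /c (sumr_off (fun l a => kp * sq (X l a))) //.
  by rewrite negbK finset.setU11.
have Fr0 a : F L (resample be i a) =
    (sq (S L be) + c (i |: L)%SET be + kp * sq (X i a)) ^+ q.
  rewrite -addrA; congr ((sq _ + _) ^+ _).
    by apply/funext => j; rewrite /S (sumr_off (fun l a => X l a j)).
  rewrite /c (bigD1 i) //= resample_eq addrC; congr (_ + _).
  rewrite -(sumr_off (fun l a => kp * sq (X l a)) a).
    by apply: eq_bigl => l; rewrite finset.in_setU1 negb_or andbC.
  by rewrite negbK finset.setU11.
under eq_bigr do rewrite Fr.
under [leRHS]eq_bigr do rewrite Fr0.
exact: symmetrization_step.
Qed.

End Symmetrization.
(** * Real symmetric matrices *)

Section RealSpectralTheorem.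
Context {R : realType}.

(** Seen over the complex numbers the matrix is Hermitian, so its spectral diagonal is real; a real
    root of the complexified characteristic polynomial is already a root of the original one. *)
Lemma symmetric_has_eigenvalue n (A : 'M[R]_n.+1) :
  A^T = A -> exists a, eigenvalue A a.
Proof.
move=> Asym; pose f := real_complex R; pose B := map_mx f A.
have Bherm : B \is hermsymmx.
  apply/is_hermitianmxP; rewrite expr0 scale1r; apply/matrixP => i j.
  have Aji : A j i = A i j by rewrite -[in LHS]Asym mxE.
  by rewrite !mxE Aji conj_Creal // complex_real.
have /hermitian_normalmx/orthomx_spectralP Beq := Bherm.
set P := spectralmx B in Beq; set D := spectral_diag B in Beq.
have Preal : D 0 0 \is Num.real.
  by have /mxOverP/(_ 0 0) := hermitian_spectral_diag_real Bherm.
have eigB : eigenvalue B (D 0 0).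
  apply/eigenvalueP; exists (row 0 P).
    rewrite Beq !mulmxA -row_mul mulmxV ?spectral_unit // -row_mul mul1mx.
    apply/rowP => j; rewrite !mxE.
    by rewrite (bigD1 0) //= big1 ?addr0 => [|k k0]; rewrite !mxE ?eqxx ?mulr1n //
      eq_sym (negbTE k0) mulr0n mul0r.
  apply/eqP => P0.
  have := row_free_unit P; rewrite spectral_unit => /row_freeP[Q PQ].
  have := congr1 (row 0) PQ; rewrite row_mul P0 mul0mx => /rowP/(_ 0).
  by rewrite !mxE eqxx => /eqP; rewrite eq_sym oner_eq0.
have /complex_realP[a aE] := Preal.
by exists a; move: eigB; rewrite aE !eigenvalue_root_char -map_char_poly fmorph_root.
Qed.

(* The Householder reflection exchanging v and the first basis vector. *)
Lemma unit_row_completion n (v : 'rV[R]_n.+1) : (v *m v^T) 0 0 = 1 ->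
  exists P : 'M[R]_n.+1, [/\ P^T = P, P *m P = 1%:M & v *m P = delta_mx 0 0].
Proof.
move=> vv; pose e : 'rV[R]_n.+1 := delta_mx 0 0.
have [ve|vNe] := eqVneq v e.
  by exists 1%:M; rewrite trmx1 !mulmx1; split.
have [u uE] : exists u : 'rV[R]_n.+1, u = v - e by exists (v - e).
pose t := v 0 0.
have vvE : v *m v^T = 1%:M.
  by apply/matrixP => i j; rewrite !ord1 vv !mxE.
have eeE : e *m e^T = 1%:M.
  by rewrite trmx_delta mul_delta_mx; apply/matrixP => i j; rewrite !ord1 !mxE.
have veE : v *m e^T = t%:M.
  by rewrite trmx_delta -colE; apply/matrixP => i j; rewrite !ord1 !mxE.
have evE : e *m v^T = t%:M by rewrite -[LHS]trmxK trmx_mul trmxK veE tr_scalar_mx.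
have vuE : v *m u^T = (1 - t)%:M.
  by rewrite uE linearB /= mulmxBr vvE veE raddfB.
have uuE : u *m u^T = (2 * (1 - t))%:M.
  rewrite {1}uE mulmxBl vuE uE linearB /= mulmxBr evE eeE -!raddfB /=.
  by congr (_%:M); ring.
have t1 : 1 - t != 0.
  apply: contra vNe => /eqP t1; rewrite t1 mulr0 in uuE.
  have : \sum_j u 0 j * u^T j 0 == 0.
    by have /matrixP/(_ 0 0) := uuE; rewrite mxE => ->; rewrite mxE mul0rn.
  rewrite psumr_eq0 => [/allP u0|i _]; last by rewrite [u^T _ _]mxE -expr2 sqr_ge0.
  rewrite -subr_eq0 -uE; apply/eqP/rowP => j; rewrite [RHS]mxE.
  have := u0 j; rewrite mem_index_enum [u^T _ _]mxE mulf_eq0 orbb.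
  by move=> /(_ isT)/eqP.
exists (1%:M - (1 - t)^-1 *: (u^T *m u)); split.
- by rewrite linearB /= trmx1 linearZ /= trmx_mul trmxK.
- rewrite mulmxBl mul1mx mulmxBr mulmx1 -scalemxAl -scalemxAr.
  rewrite -mulmxA (mulmxA u) uuE mul_scalar_mx -scalemxAr !scalerA.
  have -> : (1 - t)^-1 * ((1 - t)^-1 * (2 * (1 - t))) = (1 - t)^-1 + (1 - t)^-1.
    by field.
  by rewrite scalerDl opprD opprK addKr subrK.
- rewrite mulmxBr mulmx1 -scalemxAr mulmxA vuE mul_scalar_mx scalerA mulVf //.
  by rewrite scale1r uE opprB addrC subrK.
Qed.

(** Deflation: conjugating by a reflection that sends a unit eigenvector to the first basis vector
    clears the first row off the diagonal, hence by symmetry the first column, and the induction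
    applies to the remaining block. *)
Theorem real_spectral_theorem n (A : 'M[R]_n) : A^T = A ->
  exists (Q : 'M[R]_n) (D : 'rV[R]_n),
    Q *m Q^T = 1%:M /\ A = Q^T *m diag_mx D *m Q.
Proof.
elim: n A => [|n IH] A Asym.
  by exists 1%:M, 0; rewrite !thinmx0; split; apply/matrixP => -[].
have [a /eigenvalueP[v0 v0A v0N]] := symmetric_has_eigenvalue Asym.
pose r := (v0 *m v0^T) 0 0.
have r_gt0 : 0 < r.
  have r0 : 0 <= r by rewrite /r !mxE sumr_ge0 // => i _; rewrite mxE -expr2 sqr_ge0.
  rewrite lt_def r0 andbT; apply: contra v0N; rewrite /r mxE psumr_eq0.
    move=> /allP v00; apply/eqP/rowP => j; rewrite mxE.
    by have := v00 j; rewrite mem_index_enum mxE mulf_eq0 orbb => /(_ isT)/eqP.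
  by move=> i _; rewrite mxE -expr2 sqr_ge0.
pose v := (Num.sqrt r)^-1 *: v0.
have vA : v *m A = a *: v by rewrite /v -scalemxAl v0A !scalerA mulrC.
have vv : (v *m v^T) 0 0 = 1.
  rewrite /v linearZ /= -scalemxAl -scalemxAr scalerA mxE -/r.
  by rewrite -invfM -expr2 sqr_sqrtr ?ltW // mulVf ?gt_eqF.
have [P [Psym PP vP]] := unit_row_completion vv.
have eP : delta_mx 0 0 *m P = v by rewrite -vP -mulmxA PP mulmx1.
pose B : 'M[R]_(1 + n) := P *m A *m P.
have Bsym : B^T = B by rewrite /B !trmx_mul Psym Asym mulmxA.
have B0 : row 0 B = a *: delta_mx 0 0.
  by rewrite rowE /B !mulmxA eP vA -scalemxAl vP.
have B0j j : B 0 j = a * (j == 0)%:R.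
  by have /rowP/(_ j) := B0; rewrite !mxE eqxx.
have Bj0 j : B j 0 = a * (j == 0)%:R by rewrite -[B]Bsym mxE B0j.
have [Q' [D' [Q'Q' BE']]] : exists (Q : 'M[R]_n) (D : 'rV[R]_n),
    Q *m Q^T = 1%:M /\ drsubmx B = Q^T *m diag_mx D *m Q.
  by apply: IH; rewrite trmx_drsub Bsym.
have AE : A = P *m B *m P.
  by rewrite /B !mulmxA PP mul1mx -mulmxA PP mulmx1.
clearbody B.
have l0 : lshift n 0 = 0 :> 'I_(1 + n) by apply: val_inj.
have BE : B = block_mx a%:M 0 0 (drsubmx B).
  rewrite -[LHS]submxK; congr block_mx; apply/matrixP => i j; rewrite ?ord1.
  - by rewrite !mxE l0 ?B0j ?eqxx ?mulr1.
  - by rewrite !mxE l0 ?B0j ?mulr0.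
  - by rewrite !mxE l0 ?Bj0 ?mulr0.
pose K : 'M[R]_(1 + n) := block_mx (1%:M : 'M[R]_1) 0 0 Q' .
have KK : K *m K^T = 1%:M.
  rewrite /K tr_block_mx mulmx_block !trmx0 trmx1 !mulmx0 !mul0mx !addr0 !add0r.
  by rewrite mulmx1 Q'Q' -scalar_mx_block.
have BK : B = K^T *m diag_mx (row_mx (a%:M : 'M[R]_1) D') *m K.
  rewrite BE BE' tr_block_mx !trmx0 trmx1 diag_mx_row !mulmx_block.
  rewrite !mulmx0 !mul0mx !addr0 !add0r !mulmx1 !mul1mx mul0mx; congr block_mx.
  by apply/matrixP => i j; rewrite !ord1 !mxE.
exists ((K : 'M[R]_n.+1) *m P), (row_mx (a%:M : 'M[R]_1) D').
have PPT : P *m P^T = 1%:M by rewrite Psym.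
split; first by rewrite trmx_mul -mulmxA (mulmxA P) PPT mul1mx KK.
by rewrite AE BK trmx_mul Psym !mulmxA.
Qed.
End RealSpectralTheorem.

(** * Euclidean geometry of columns and positive definite matrices *)

Section EuclideanColumns.
Context {R : realType} {d : nat}.
Implicit Types (u v w : 'cV[R]_d) (A M : 'M[R]_d).

Lemma dotvE u v : dotv u v = \sum_i u i 0 * v i 0.
Proof. by rewrite /dotv mxE; apply: eq_bigr => i _; rewrite mxE. Qed.

Lemma dotv_dotf u v : dotv u v = dotf (fun i => u i 0) (fun i => v i 0).
Proof. exact: dotvE. Qed.

Lemma dotvC u v : dotv u v = dotv v u.
Proof. by rewrite !dotvE; apply: eq_bigr => i _; rewrite mulrC. Qed.

Lemma dotvDr u v w : dotv u (v + w) = dotv u v + dotv u w.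
Proof. by rewrite /dotv mulmxDr mxE. Qed.

Lemma dotvDl u v w : dotv (u + v) w = dotv u w + dotv v w.
Proof. by rewrite !(dotvC _ w) dotvDr. Qed.

Lemma dotvNr u v : dotv u (- v) = - dotv u v.
Proof. by rewrite /dotv mulmxN mxE. Qed.

Lemma dotvNl u v : dotv (- u) v = - dotv u v.
Proof. by rewrite !(dotvC _ v) dotvNr. Qed.

Lemma dotvBr u v w : dotv u (v - w) = dotv u v - dotv u w.
Proof. by rewrite dotvDr dotvNr. Qed.

Lemma dotvBl u v w : dotv (u - v) w = dotv u w - dotv v w.
Proof. by rewrite dotvDl dotvNl. Qed.

Lemma dotvZr a u v : dotv u (a *: v) = a * dotv u v.
Proof. by rewrite /dotv -scalemxAr mxE. Qed.

Lemma dotvZl a u v : dotv (a *: u) v = a * dotv u v.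
Proof. by rewrite !(dotvC _ v) dotvZr. Qed.

Lemma dotv0 u : dotv u 0 = 0.
Proof. by rewrite /dotv mulmx0 mxE. Qed.

Lemma dotv_sumr (I : finType) (F : I -> 'cV[R]_d) u :
  dotv u (\sum_i F i) = \sum_i dotv u (F i).
Proof. by rewrite /dotv mulmx_sumr summxE. Qed.

Lemma dotv_mull (B : 'M[R]_d) u v : dotv (B *m u) v = dotv u (B^T *m v).
Proof. by rewrite /dotv trmx_mul mulmxA. Qed.

Lemma mul_col_row_col u v : u *m u^T *m v = dotv u v *: u.
Proof.
rewrite -mulmxA (_ : u^T *m v = (dotv u v)%:M) ?mul_mx_scalar //.
by apply/matrixP => i j; rewrite !ord1 [RHS]mxE.
Qed.

Lemma dotv_ge0 u : 0 <= dotv u u.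
Proof. by rewrite dotv_dotf dotf_ge0. Qed.

Lemma dotv_eq0 u : dotv u u = 0 -> u = 0.
Proof.
move=> /eqP; rewrite dotvE psumr_eq0 => [/allP u0|i _]; last by rewrite -expr2 sqr_ge0.
apply/colP => i; rewrite mxE; apply/eqP; have := u0 i.
by rewrite mem_index_enum mulf_eq0 orbb; exact.
Qed.

Lemma l2norm_ge0 u : 0 <= l2norm u. Proof. exact: sqrtr_ge0. Qed.

Lemma sqr_l2norm u : l2norm u ^+ 2 = dotv u u.
Proof. by rewrite sqr_sqrtr // dotv_ge0. Qed.

Lemma dotv_le u v : `|dotv u v| <= l2norm u * l2norm v.
Proof. by rewrite dotv_dotf; apply: le_trans (dotf_norm_le _ _) _; rewrite /normf -!dotv_dotf. Qed.

Lemma l2normZ a u : l2norm (a *: u) = `|a| * l2norm u.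
Proof.
by rewrite /l2norm dotvZl dotvZr mulrA -expr2 sqrtrM ?sqr_ge0 // sqrtr_sqr.
Qed.

Lemma l2normN u : l2norm (- u) = l2norm u.
Proof. by rewrite -scaleN1r l2normZ normrN1 mul1r. Qed.

Lemma l2norm_eq0 u : l2norm u = 0 -> u = 0.
Proof. by move=> u0; apply: dotv_eq0; rewrite -sqr_l2norm u0 expr0n. Qed.

Lemma l2norm0 : l2norm (0 : 'cV[R]_d) = 0.
Proof. by rewrite /l2norm dotv0 sqrtr0. Qed.

(** Cauchy-Schwarz on each row bounds the set by the Frobenius norm; this makes [sup] a genuine
    supremum and not its default value. *)
Lemma spectral_norm_has_sup A :
  has_sup [set l2norm (A *m v) | v in [set v | l2norm v <= 1]].
Proof.
split; first by exists (l2norm (A *m 0)), 0; rewrite //= l2norm0.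
pose fr := \sum_i \sum_j A i j ^+ 2.
have fr0 : 0 <= fr by apply: sumr_ge0 => i _; apply: sumr_ge0 => j _; rewrite sqr_ge0.
exists (Num.sqrt fr) => _ [v /= v1 <-].
rewrite ler_sqrt // dotvE ler_sum // => i _.
have -> : (A *m v) i 0 = dotf (fun j => A i j) (fun j => v j 0) by rewrite mxE.
rewrite -expr2; apply: le_trans (dotf_sqr_le _ _) _.
rewrite -dotv_dotf -sqr_l2norm.
have f0 : 0 <= dotf (fun j => A i j) (fun j => A i j) by exact: dotf_ge0.
apply: (@le_trans _ _ (dotf (fun j => A i j) (fun j => A i j))).
  by rewrite ler_piMr // expr_le1 // l2norm_ge0.
by apply: ler_sum => j _; rewrite expr2.
Qed.

Lemma spectral_norm_mul_le A v : l2norm (A *m v) <= spectral_norm A * l2norm v.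
Proof.
have [v0|v0] := eqVneq (l2norm v) 0.
  by rewrite v0 mulr0 (l2norm_eq0 v0) mulmx0 l2norm0.
have vp : 0 < l2norm v by rewrite lt_def v0 l2norm_ge0.
rewrite -ler_pdivrMr // mulrC.
have -> : (l2norm v)^-1 * l2norm (A *m v) = l2norm (A *m ((l2norm v)^-1 *: v)).
  by rewrite -scalemxAr l2normZ ger0_norm // invr_ge0 l2norm_ge0.
apply: ub_le_sup; first by case: (spectral_norm_has_sup A).
exists ((l2norm v)^-1 *: v) => //=.
by rewrite l2normZ ger0_norm ?invr_ge0 ?l2norm_ge0 // mulVf.
Qed.

Lemma spectral_norm_ge0 A : 0 <= spectral_norm A.
Proof.
apply: le_trans (l2norm_ge0 (A *m 0)) _; apply: ub_le_sup.
  by case: (spectral_norm_has_sup A).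
by exists 0; rewrite //= l2norm0.
Qed.

End EuclideanColumns.

Section PositiveDefinite.
Context {R : realType} {d : nat}.
Implicit Types (u v w : 'cV[R]_d) (A H M S Z : 'M[R]_d).

Definition posdef M := M^T = M /\ forall v, v != 0 -> 0 < dotv v (M *m v).

Lemma posdef_spectral M : posdef M -> exists (Q : 'M[R]_d) (D : 'rV[R]_d),
  [/\ Q *m Q^T = 1%:M, Q^T *m Q = 1%:M, M = Q^T *m diag_mx D *m Q &
      forall i, 0 < D 0 i].
Proof.
move=> [Msym Mpos]; have [Q [D [QQ ME]]] := real_spectral_theorem Msym.
have QTQ := mulmx1C QQ; exists Q, D; split => // i.
pose e : 'cV[R]_d := delta_mx i 0.
have Qe : Q *m (Q^T *m e) = e by rewrite mulmxA QQ mul1mx.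
have eN : Q^T *m e != 0.
  apply/eqP => e0; move: Qe; rewrite e0 mulmx0 => /colP/(_ i)/eqP.
  by rewrite !mxE !eqxx eq_sym oner_eq0.
have := Mpos _ eN; rewrite dotv_mull trmxK ME -!mulmxA Qe mulmxA QQ mul1mx.
rewrite dotvE (bigD1 i) //= big1 => [|j ji]; last first.
  by rewrite mxE (negbTE ji) mul0r.
by rewrite addr0 mul_diag_mx !mxE !eqxx !mulr1 mul1r.
Qed.

Lemma posdef_unit M : posdef M -> M \in unitmx.
Proof.
move=> /posdef_spectral[Q [D [QQ QTQ -> D0]]].
have [uQ _] := mulmx1_unit QTQ; have [uQT _] := mulmx1_unit QQ.
rewrite !unitmx_mul uQ uQT andbT /= unitmxE det_diag unitfE.
by apply/prodf_neq0 => i _; rewrite gt_eqF.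
Qed.

(* S = D^{-1/2} Q for the spectral decomposition H = Q^T D Q. *)
Lemma posdef_whitening H : posdef H -> exists S, [/\ S \in unitmx,
  S *m H *m S^T = 1%:M & S^T *m S = invmx H].
Proof.
move=> Hpd; have Hu := posdef_unit Hpd.
have [Q [D [QQ QTQ HE D0]]] := posdef_spectral Hpd.
pose E := \row_i (Num.sqrt (D 0 i))^-1.
have ED : diag_mx E *m diag_mx D *m diag_mx E = 1%:M.
  rewrite !mulmx_diag; apply/matrixP => i j; rewrite !mxE; congr (_ *+ _).
  have s0 : Num.sqrt (D 0 i) != 0 by rewrite gt_eqF // sqrtr_gt0.
  by rewrite -[X in _ * X * _](@sqr_sqrtr _ (D 0 i)) ?ltW //; field.
pose S := diag_mx E *m Q.
have SHS : S *m H *m S^T = 1%:M.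
  rewrite /S trmx_mul tr_diag_mx HE !mulmxA -(mulmxA _ Q) QQ mulmx1.
  by rewrite -(mulmxA _ Q) QQ mulmx1.
have Su : S \in unitmx by move: SHS; rewrite -mulmxA => /mulmx1_unit[].
exists S; split => //.
have /mulmx1C : S *m (H *m S^T) = 1%:M by rewrite mulmxA.
by rewrite -mulmxA => /(congr1 (mulmx (invmx H))); rewrite mulKmx // mulmx1.
Qed.

Lemma l2norm_orthogonal (Q : 'M[R]_d) v : Q^T *m Q = 1%:M -> l2norm (Q *m v) = l2norm v.
Proof. by move=> QQ; rewrite /l2norm dotv_mull mulmxA QQ mul1mx. Qed.

Lemma diag_mul_col (D : 'rV[R]_d) v i : (diag_mx D *m v) i 0 = D 0 i * v i 0.
Proof. by rewrite mul_diag_mx mxE. Qed.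

Lemma dotv_spectral (Q : 'M[R]_d) D v :
  dotv v (Q^T *m diag_mx D *m Q *m v) = \sum_i D 0 i * (Q *m v) i 0 ^+ 2.
Proof.
rewrite -!mulmxA -[Q^T]/(Q^T) -[X in dotv _ (X *m _)]/(Q^T) -dotv_mull dotvE.
by apply: eq_bigr => i _; rewrite diag_mul_col; ring.
Qed.

Lemma dotv_orthogonal (Q : 'M[R]_d) v : Q^T *m Q = 1%:M ->
  dotv v v = \sum_i (Q *m v) i 0 ^+ 2.
Proof.
move=> QQ; rewrite -sqr_l2norm -(l2norm_orthogonal v QQ) sqr_l2norm dotvE.
by apply: eq_bigr => i _; rewrite expr2.
Qed.

(** The least diagonal entry of a spectral decomposition bounds the Rayleigh quotient from below and
    is itself an eigenvalue, so the infimum is attained there; d > 0 provides an index at which to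
    take it. *)
Lemma posdef_lambda_min H : (0 < d)%N -> posdef H ->
  0 < lambda_min H /\ forall v, lambda_min H * dotv v v <= dotv v (H *m v).
Proof.
move=> d0 /posdef_spectral[Q [D [QQ QTQ HE D0]]].
pose i0 := [arg min_(i < Ordinal d0) D 0 i]%O.
have Dmin i : D 0 i0 <= D 0 i by rewrite /i0; case: arg_minP => // j _; exact.
have rayleigh v : D 0 i0 * dotv v v <= dotv v (H *m v).
  rewrite HE dotv_spectral (dotv_orthogonal v QTQ) mulr_sumr.
  by apply: ler_sum => i _; rewrite ler_wpM2r ?sqr_ge0.
suff -> : lambda_min H = D 0 i0 by [].
apply/eqP; rewrite eq_le; apply/andP; split.
  apply: ge_inf.
    exists (D 0 i0) => a /= /eigenvalueP[v vH v0].
    (* Eigenvectors are rows acted on from the right; symmetry of H turns them into columns. *)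
    have Hv : H *m v^T = a *: v^T.
      have HT : H^T = H by rewrite HE !trmx_mul trmxK tr_diag_mx mulmxA.
      by rewrite -[in LHS]HT -trmx_mul vH linearZ.
    have := rayleigh v^T; rewrite Hv dotvZr ler_pM2r // lt_def dotv_ge0 andbT.
    by apply: contra v0 => /eqP/dotv_eq0/(congr1 trmx); rewrite trmxK trmx0 => ->.
  apply/eigenvalueP; exists (row i0 Q).
    rewrite HE !mulmxA -!row_mul QQ mul1mx row_mul; apply/rowP => j.
    by rewrite row_diag_mx -scalemxAl -rowE !mxE.
  apply/eqP => Q0; have := congr1 (row i0) QQ; rewrite row_mul Q0 mul0mx.
  by move=> /rowP/(_ i0)/eqP; rewrite !mxE eqxx eq_sym oner_eq0.
apply: lb_le_inf.
  exists (D 0 i0); apply/eigenvalueP; exists (row i0 Q).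
    rewrite HE !mulmxA -!row_mul QQ mul1mx row_mul; apply/rowP => j.
    by rewrite row_diag_mx -scalemxAl -rowE !mxE.
  apply/eqP => Q0; have := congr1 (row i0) QQ; rewrite row_mul Q0 mul0mx.
  by move=> /rowP/(_ i0)/eqP; rewrite !mxE eqxx eq_sym oner_eq0.
move=> a /= /eigenvalueP[v vH v0].
have Hv : H *m v^T = a *: v^T.
  have HT : H^T = H by rewrite HE !trmx_mul trmxK tr_diag_mx mulmxA.
  by rewrite -[in LHS]HT -trmx_mul vH linearZ.
have := rayleigh v^T; rewrite Hv dotvZr ler_pM2r // lt_def dotv_ge0 andbT.
by apply: contra v0 => /eqP/dotv_eq0/(congr1 trmx); rewrite trmxK trmx0 => ->.
Qed.

Lemma dotv_mul_le_spectral_norm H v : dotv v (H *m v) <= spectral_norm H * dotv v v.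
Proof.
apply: le_trans (ler_norm _) _; apply: le_trans (dotv_le _ _) _.
rewrite -sqr_l2norm expr2 mulrCA ler_wpM2l ?l2norm_ge0 //.
exact: spectral_norm_mul_le.
Qed.

(** For v = S^T y with S whitening H, |y|^2 = v.Hv and |v|^2 = y.(S v), while |S v|^2 = v.(H^-1 v)
    is at most the norm of H^-1 times |v|^2. Cauchy-Schwarz, then division by |v|^2. *)
Lemma dotv_le_spectral_norm_inv H v : posdef H ->
  dotv v v <= spectral_norm (invmx H) * dotv v (H *m v).
Proof.
move=> Hpd; have [S [Su SHS SS]] := posdef_whitening Hpd.
have [->|vN] := eqVneq v 0; first by rewrite mulmx0 !dotv0 mulr0.
have v0 : 0 < dotv v v.
  by rewrite lt_def dotv_ge0 andbT; apply: contra vN => /eqP/dotv_eq0->.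
pose y := (invmx S)^T *m v.
have vE : v = S^T *m y by rewrite /y mulmxA -trmx_mul mulVmx // trmx1 mul1mx.
have yy : dotv y y = dotv v (H *m v).
  by rewrite {2}vE !mulmxA {1}vE dotv_mull trmxK !mulmxA SHS mul1mx.
have vv : dotv v v = dotv y (S *m v) by rewrite {1}vE dotv_mull trmxK.
have SvSv : dotv (S *m v) (S *m v) <= spectral_norm (invmx H) * dotv v v.
  by rewrite dotv_mull mulmxA SS dotv_mul_le_spectral_norm.
have := dotv_le y (S *m v); rewrite -vv ger0_norm ?dotv_ge0 // => h.
have := h; rewrite -ler_sqr ?nnegrE ?mulr_ge0 ?l2norm_ge0 ?dotv_ge0 //.
rewrite exprMn !sqr_l2norm => h2.
rewrite -(ler_pM2r v0) -expr2; apply: le_trans h2 _.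
by rewrite yy mulrAC mulrC ler_wpM2r // -yy dotv_ge0.
Qed.

End PositiveDefinite.

(** * Determinant and inverse of a positive definite matrix compared with the identity *)

Section DeterminantDeviation.
Context {R : realType} {d : nat}.
Variable Z : 'M[R]_d.
Hypothesis Zpd : posdef Z.

Let tau := \tr (Z - 1%:M).
Let F := normf (fun ij : 'I_d * 'I_d => (Z - 1%:M) ij.1 ij.2).

Lemma frobenius_trace (A : 'M[R]_d) :
  dotf (fun ij : 'I_d * 'I_d => A ij.1 ij.2) (fun ij => A ij.1 ij.2)
  = \tr (A *m A^T).
Proof.
rewrite /dotf -(pair_bigA _ (fun i j => A i j * A i j)) /=.
by apply: eq_bigr => i _; rewrite !mxE; apply: eq_bigr => j _; rewrite mxE.
Qed.

Let spectral : exists (Q : 'M[R]_d) (D : 'rV[R]_d),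
  [/\ Q *m Q^T = 1%:M, Q^T *m Q = 1%:M, Z = Q^T *m diag_mx D *m Q &
      [/\ forall i, 0 < D 0 i, \det Z = \prod_i D 0 i,
       tau = \sum_i (D 0 i - 1) & F ^+ 2 = \sum_i (D 0 i - 1) ^+ 2]].
Proof.
have [Q [D [QQ QTQ ZE D0]]] := posdef_spectral Zpd.
have Z1 : Z - 1%:M = Q^T *m diag_mx (\row_i (D 0 i - 1)) *m Q.
  have -> : diag_mx (\row_i (D 0 i - 1)) = diag_mx D - 1%:M.
    by apply/matrixP => i j; rewrite !mxE mulrnBl.
  by rewrite mulmxBr mulmxBl -ZE mulmx1 QTQ.
exists Q, D; split => //; split => //.
- rewrite ZE !det_mulmx mulrAC -det_mulmx QTQ det1 mul1r det_diag //.
- rewrite /tau Z1 mxtrace_mulC mulmxA QQ mul1mx mxtrace_diag.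
  by apply: eq_bigr => i _; rewrite mxE.
- rewrite /F sqr_normf frobenius_trace Z1 !trmx_mul trmxK tr_diag_mx !mulmxA.
  rewrite -(mulmxA _ Q) QQ mulmx1 mxtrace_mulC !mulmxA QQ mul1mx mulmx_diag.
  by rewrite mxtrace_diag; apply: eq_bigr => i _; rewrite !mxE expr2.
Qed.

(** If F >= 1/2 the bound holds because the determinant is nonnegative. Otherwise every eigenvalue 1
    + e has e >= -1/2, where 1 + e >= exp (e - 2 e^2); the product gives det Z >= exp (tau - 2 F^2),
    and F^2 <= F / 2. *)
Lemma one_sub_det_le : 1 - \det Z <= `|tau| + 2 * F.
Proof.
have [Q [D [QQ QTQ ZE [D0 detE tauE FE]]]] := spectral.
have F0 : 0 <= F := normf_ge0 _.
have det0 : 0 <= \det Z by rewrite detE prodr_ge0 // => i _; exact: ltW.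
have [F12|F12] := leP (1 / 2) F; first by have := normr_ge0 tau; lra.
have eF i : `|D 0 i - 1| <= F.
  rewrite -ler_sqr ?nnegrE // real_normK ?num_real // FE (bigD1 i) //= lerDl.
  by apply: sumr_ge0 => j _; rewrite sqr_ge0.
have step i : expR ((D 0 i - 1) - 2 * (D 0 i - 1) ^+ 2) <= D 0 i.
  have := eF i; rewrite ler_norml => /andP[e1 _].
  have {e1} : - (1 / 2) <= D 0 i - 1 by lra.
  rewrite -[in X in _ -> _ <= X](subrK 1 (D 0 i)).
  move: (D 0 i - 1) => e e1.
  have p0 : 0 < 1 + (2 * e ^+ 2 - e) by nra.
  (* Indeed (1 - e + 2 e^2) (1 + e) = 1 + e^2 (1 + 2 e), and the first factor is at most exp (2 e^2
     - e). *)
  have h : 0 <= e ^+ 2 * (1 + 2 * e) by rewrite mulr_ge0 ?sqr_ge0 //; lra.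
  have le1 : (1 + (2 * e ^+ 2 - e)) * (e + 1) <= expR (2 * e ^+ 2 - e) * (e + 1).
    by rewrite ler_wpM2r ?expR_ge1Dx //; lra.
  rewrite -[e - _]opprB expRN -[leLHS]mul1r ler_pdivrMr ?expR_gt0 // mulrC.
  by apply: le_trans le1; lra.
have : expR (tau - 2 * F ^+ 2) <= \det Z.
  rewrite detE tauE FE mulr_sumr -sumrB expR_sum.
  by apply: ler_prod => i _; rewrite expR_ge0 step.
have := expR_ge1Dx (tau - 2 * F ^+ 2).
have : F ^+ 2 <= F / 2 by rewrite expr2 ler_wpM2l //; lra.
by have := ler_norm (- tau); rewrite normrN; lra.
Qed.

(* In an eigenbasis the i-th coordinate is multiplied by
   (prod_{j != i} D_j) (1 - D_i), where the product is at most
   exp (tau - (D_i - 1)) <= exp (1 + tau). *)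
Lemma det_inv_deviation (q : 'cV[R]_d) :
  l2norm (\det Z *: (invmx Z *m q - q)) <= expR (1 + tau) * F * l2norm q.
Proof.
have Zu := posdef_unit Zpd.
have [Q [D [QQ QTQ ZE [D0 detE tauE FE]]]] := spectral.
have F0 : 0 <= F := normf_ge0 _.
have eF i : `|D 0 i - 1| <= F.
  rewrite -ler_sqr ?nnegrE // real_normK ?num_real // FE (bigD1 i) //= lerDl.
  by apply: sumr_ge0 => j _; rewrite sqr_ge0.
pose c i := (\prod_(j | j != i) D 0 j) * (1 - D 0 i).
have cle i : `|c i| <= expR (1 + tau) * F.
  rewrite /c normrM distrC; apply: ler_pM; rewrite ?normr_ge0 //.
  rewrite ger0_norm; last by apply: prodr_ge0 => j _; exact: ltW.
  apply: (@le_trans _ _ (expR (\sum_(j | j != i) (D 0 j - 1)))).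
    rewrite expR_sum; apply: ler_prod => j _; rewrite (ltW (D0 j)) /=.
    by have := expR_ge1Dx (D 0 j - 1); lra.
  by rewrite ler_expR tauE [in leRHS](bigD1 i) //=; have := D0 i; lra.
have invE : invmx Z = Q^T *m diag_mx (\row_i (D 0 i)^-1) *m Q.
  have : Z *m (Q^T *m diag_mx (\row_i (D 0 i)^-1) *m Q) = 1%:M.
    rewrite ZE !mulmxA -(mulmxA _ Q) QQ mulmx1 -(mulmxA _ (diag_mx D)) mulmx_diag.
    rewrite (_ : diag_mx _ = 1%:M) ?mulmx1 //; apply/matrixP => i j; rewrite !mxE.
    by rewrite divff // gt_eqF.
  by move=> /(congr1 (mulmx (invmx Z))); rewrite mulKmx // mulmx1 => ->.
have E : \det Z *: (invmx Z *m q - q) = Q^T *m (diag_mx (\row_i c i) *m (Q *m q)).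
  have -> : invmx Z *m q - q =
      Q^T *m ((diag_mx (\row_i (D 0 i)^-1) - 1%:M) *m (Q *m q)).
    by rewrite mulmxBl mul1mx mulmxBr !mulmxA QTQ mul1mx -invE.
  rewrite scalemxAr scalemxAl; congr (_ *m (_ *m _)).
  apply/matrixP => i j; rewrite !mxE /c detE (bigD1 i) //=.
  have := gt_eqF (D0 i); move: (D 0 i) => Di /negbT Di0.
  by case: eqVneq => _; rewrite ?mulr1n ?mulr0n; [field|rewrite subrr mulr0].
have QQ' : (Q^T)^T *m Q^T = 1%:M by rewrite trmxK.
rewrite E (l2norm_orthogonal _ QQ') -(l2norm_orthogonal q QTQ).
set y := Q *m q.
rewrite -ler_sqr ?nnegrE ?mulr_ge0 ?expR_ge0 ?l2norm_ge0 //.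
rewrite exprMn !sqr_l2norm !dotvE mulr_sumr; apply: ler_sum => i _.
rewrite diag_mul_col mxE -!expr2 exprMn ler_wpM2r ?sqr_ge0 //.
rewrite -[leLHS]real_normK ?num_real // ler_sqr ?nnegrE ?normr_ge0 //.
by rewrite mulr_ge0 ?expR_ge0.
Qed.

End DeterminantDeviation.
(** * Determinants of subsampled matrices *)

Section RankOneAffine.
Context {R : realType}.

Definition rank1_affine d (f : 'M[R]_d -> R) :=
  forall (M : 'M[R]_d) (u : 'cV[R]_d) (v : 'rV[R]_d),
    exists c, forall s, f (M + s *: (u *m v)) = f M + s * c.

(* det (M + s u v) is the determinant of the bordered matrix [1, -s v; u, M],
   which is affine in its first row. *)
Lemma rank1_affine_det d : rank1_affine (fun M : 'M[R]_d => \det M).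
Proof.
move=> M u v.
pose K s : 'M[R]_(1 + d) := block_mx (1%:M : 'M[R]_1) (- (s *: v)) u M.
pose C : 'M[R]_(1 + d) := block_mx (0 : 'M[R]_1) (- v) u M.
have KE s : \det (K s) = \det (M + s *: (u *m v)).
  have -> : \det (K s) = \det (block_mx (1%:M : 'M[R]_1) 0 (- u) 1%:M *m K s).
    by rewrite det_mulmx det_lblock !det1 !mul1r.
  rewrite mulmx_block !mul1mx !mul0mx !addr0 mulmx1 addNr.
  by rewrite det_ublock det1 mul1r mulNmx mulmxN opprK -scalemxAr addrC.
exists (\det C) => s.
have -> : \det M = \det (K 0) by rewrite KE scale0r addr0.
rewrite -KE -[\det (K 0)]mul1r.
have row'E (A : 'M[R]_1) (B : 'rV[R]_d) (A' : 'M[R]_1) (B' : 'rV[R]_d) :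
    row' (lshift d 0) (block_mx A B u M) = row' (lshift d 0) (block_mx A' B' u M).
  rewrite /block_mx; apply/matrixP => i j; rewrite 2![row' _ _ _ _]mxE.
  have := neq_lift (lshift d (0 : 'I_1)) i; move: (lift _ i) => l l0.
  have [k lE|k lE] := split_ordP l; last by rewrite lE !col_mxEd.
  by move: l0; rewrite lE [k]ord1 eqxx.
apply: (@determinant_multilinear _ _ _ _ _ (lshift d (0 : 'I_1))); last 2 first.
- exact: row'E.
- exact: row'E.
rewrite /K /C /block_mx !rowKu !row_id !scale_row_mx add_row_mx.
by rewrite scaler0 addr0 !scale0r scale1r oppr0 scaler0 add0r scalerN.
Qed.

(** Deleting a row and a column of a rank-one matrix leaves a rank-one matrix, so the determinant
    case applies to the minor. *)
Lemma rank1_affine_cofactor d i j : rank1_affine (fun M : 'M[R]_d => cofactor M i j).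
Proof.
case: d i j => [|d] i j; first by case: i.
move=> M u v.
have [c cE] := rank1_affine_det (row' i (col' j M)) (row' i u) (col' j v).
exists ((-1) ^+ (i + j) * c) => s; rewrite /cofactor.
have -> : row' i (col' j (M + s *: (u *m v))) =
    row' i (col' j M) + s *: (row' i u *m col' j v).
  by apply/matrixP => a b; rewrite !mxE !big_ord1 !mxE.
by rewrite cE; ring.
Qed.

(** Coordinates are integrated out one at a time, each replacing a random coefficient by its mean.
    The hybrid argument yields inequalities only, so it is run for f and for - f. *)
Lemma prodE_rank1_affine d (I A : finType) (pi c : I -> A -> R)
    (f : 'M[R]_d -> R) (M : 'M[R]_d) (u : I -> 'cV[R]_d) (v : I -> 'rV[R]_d) :
  (forall i a, 0 <= pi i a) -> (forall i, \sum_a pi i a = 1) -> rank1_affine f ->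
  prodE pi (fun be => f (M + \sum_i c i (be i) *: (u i *m v i))) =
  f (M + \sum_i (\sum_a pi i a * c i a) *: (u i *m v i)).
Proof.
move=> pi0 pi1; move: f.
have le1 f : rank1_affine f ->
  prodE pi (fun be => f (M + \sum_i c i (be i) *: (u i *m v i))) <=
  f (M + \sum_i (\sum_a pi i a * c i a) *: (u i *m v i)).
  move=> faff; pose m i := \sum_a pi i a * c i a.
  pose U i := u i *m v i.
  pose F (L : {set I}) (be : {ffun I -> A}) :=
    f (M + \sum_(i in L) c i (be i) *: U i + \sum_(i | i \notin L) m i *: U i).
  have -> : prodE pi (fun be => f (M + \sum_i c i (be i) *: (u i *m v i))) =
      prodE pi (F [set: I]%SET).
    apply: eq_bigr => be _; congr (_ * f _); rewrite /F.
    rewrite [X in _ = _ + X]big_pred0 => [|i]; last by rewrite finset.in_setT.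
    by rewrite addr0; congr (_ + _); apply: eq_bigl => i; rewrite finset.in_setT.
  have -> : f (M + \sum_i (\sum_a pi i a * c i a) *: (u i *m v i)) =
      prodE pi (F finset.set0).
    rewrite -[LHS](prodE_cst pi1); apply: eq_bigr => be _; congr (_ * f _).
    rewrite [X in _ = _ + X + _]big_pred0 => [|i]; last by rewrite finset.in_set0.
    by rewrite addr0; congr (_ + _); apply: eq_bigl => i; rewrite finset.in_set0.
  apply: prodE_hybrid => // L i be iL.
  pose N := M + \sum_(j in L) c j (be j) *: U j +
    \sum_(j | j \notin (i |: L)%SET) m j *: U j.
  have offL a : \sum_(j in L) c j (resample be i a j) *: U j =
      \sum_(j in L) c j (be j) *: U j.
    apply: eq_bigr => j jL; rewrite resample_neq //.
    by apply: contraNneq iL => <-.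
  have Fr a : F (i |: L)%SET (resample be i a) = f (N + c i a *: U i).
    congr f; rewrite big_setU1 //= offL resample_eq /N.
    by rewrite -!addrA; congr (_ + _); rewrite addrC -addrA.
  have Fr0 a : F L (resample be i a) = f (N + m i *: U i).
    have AC (a1 a2 a3 a4 : 'M[R]_d) : a1 + a2 + (a4 + a3) = a1 + a2 + a3 + a4.
      by rewrite [a4 + a3]addrC addrA.
    have sD : \sum_(j | j \notin L) m j *: U j =
        m i *: U i + \sum_(j | j \notin (i |: L)%SET) m j *: U j.
      rewrite (bigD1 i) //=; congr (_ + _); apply: eq_bigl => j.
      by rewrite finset.in_setU1 negb_or andbC.
    by rewrite /F offL sD AC.
  under eq_bigr do rewrite Fr.
  under [leRHS]eq_bigr do rewrite Fr0.
  have [k kE] := faff N (u i) (v i).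
  rewrite -mulr_suml pi1 mul1r kE.
  under eq_bigr do rewrite kE mulrDr mulrA.
  by rewrite big_split /= -!mulr_suml pi1 mul1r.
move=> f faff; apply/eqP; rewrite eq_le le1 //=.
have Nf : rank1_affine (fun M => - f M).
  by move=> M' u' v'; have [k kE] := faff M' u' v'; exists (- k) => s; rewrite kE; ring.
have := le1 _ Nf.
rewrite (_ : prodE _ _ = - prodE pi (fun be => f (M + \sum_i c i (be i) *: (u i *m v i)))).
  by rewrite lerN2.
by rewrite /prodE -sumrN; apply: eq_bigr => be _; rewrite mulrN.
Qed.

End RankOneAffine.

(** * From the random bits to a finite product expectation *)

Section Law.
Context {R : realType}.

(** The event is a finite disjoint union of measurable fibres, so its measurability comes for
    free. *)
Lemma prob_finite_valued (dT : measure_display) (T : measurableType dT)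
    (P : probability T R) (B : finType) (Y : T -> B) (wt : B -> R) (E : pred B) :
  (forall y, measurable (Y @^-1` [set y])) ->
  (forall y, P (Y @^-1` [set y]) = (wt y)%:E) ->
  P [set om | E (Y om)] = (\sum_(y | E y) wt y)%:E.
Proof.
move=> mY PY.
have -> : [set om | E (Y om)] = \big[setU/set0]_(y | E y) (Y @^-1` [set y]).
  rewrite -bigcup_seq_cond; apply/seteqP; split => om /=.
    by move=> Ey; exists (Y om) => //=; rewrite mem_index_enum.
  by move=> [y /= /andP[_ Ey] Yy]; rewrite Yy.
have := index_enum_uniq B; elim: (index_enum B) => [|y s IH].
  by rewrite !big_nil measure0.
rewrite !big_cons => /= /andP[ys us]; case: ifPn => _; last exact: IH.
rewrite measureU //=; first by rewrite PY IH // -EFinD.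
  by apply: bigsetU_measurable => z _; exact: mY.
apply/seteqP; split => // om [/= Yy].
rewrite -bigcup_seq_cond => -[z /= /andP[zs _] Yz].
by move: ys; rewrite -Yy Yz zs.
Qed.

Definition bern (p : R) (b : bool) : R := if b then p else 1 - p.

Lemma bern_ge0 p b : 0 <= p <= 1 -> 0 <= bern p b.
Proof. by case: b => /= /andP[p0 p1]; rewrite /bern // subr_ge0. Qed.

Lemma bern_sum1 p : \sum_b bern p b = 1.
Proof. by rewrite big_bool /= addrC subrK. Qed.

Lemma bernoulli_prob_set1 p b : 0 <= p <= 1 ->
  bernoulli_prob p [set b] = (bern p b)%:E.
Proof.
move=> p01; rewrite /bernoulli_prob p01 fsbig_set1.
by case: b.
Qed.

(** The array of bits is read as a family of m whole samples. The weight is thus a product over t of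
    products over i, matching the two levels of averaging: determinants inside one copy, sums of
    errors across copies. *)
Lemma bernoulli_family_law (dT : measure_display) (T : measurableType dT)
    (P : probability T R) (m n : nat) (b : 'I_m -> 'I_n -> {RV P >-> bool}) (p : R) 
    (E : pred {ffun 'I_m -> {ffun 'I_n -> bool}}) :
  0 <= p <= 1 ->
  (forall t i, distribution P (b t i) = bernoulli_prob p) ->
  mutually_independent (fun ti : 'I_m * 'I_n => b ti.1 ti.2) ->
  P [set om | E [ffun t => [ffun i => b t i om]]] =
  (prodE (fun (_ : 'I_m) (be : {ffun 'I_n -> bool}) => \prod_i bern p (be i)) (fun be => (E be)%:R))%:E.
Proof.
move=> p01 dist indep.
pose Y om := [ffun t => [ffun i => b t i om]] : {ffun 'I_m -> {ffun 'I_n -> bool}}.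
have YE be : Y @^-1` [set be] =
    \bigcap_(ti in [set` [set: 'I_m * 'I_n]%SET]) (b ti.1 ti.2 @^-1` [set be ti.1 ti.2]).
  apply/seteqP; split => om /=.
    by move=> <- ti _ /=; rewrite !ffunE.
  move=> h; apply/ffunP => t; apply/ffunP => i; rewrite !ffunE.
  by apply: (h (t, i)) => /=; rewrite finset.in_setT.
have mb t i (c : bool) : measurable (b t i @^-1` [set c]).
  by rewrite -[_ @^-1` _]setTI; apply: (measurable_funP (b t i)).
have mY be : measurable (Y @^-1` [set be]).
  rewrite YE; apply: fin_bigcap_measurable; first exact: finite_finset.
  by move=> ti _; exact: mb.
have PY be : P (Y @^-1` [set be]) = (\prod_t \prod_i bern p (be t i))%:E.
  rewrite YE (indep _ (fun ti => [set be ti.1 ti.2])) //.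
  rewrite pair_bigA /= -prodEFin.
  apply: eq_big => [ti|ti _]; first by rewrite finset.in_setT.
  by rewrite -bernoulli_prob_set1 // -(dist ti.1 ti.2).
rewrite (prob_finite_valued E mY PY); congr (_%:E).
rewrite /prodE big_mkcond /=; apply: eq_bigr => be _.
by case: (E be); rewrite ?mulr1 ?mulr0.
Qed.

End Law.

(** * Concentration for the whitened subsampled matrices *)

Section SubsampledDeterminant.
Context {R : realType} {n d : nat}.
Variables (W : 'M[R]_d) (v : 'I_n -> 'cV[R]_d) (k B0 r : R).
Hypotheses (d_gt0 : (0 < d)%N) (k_gt0 : 0 < k) (k_le : k <= n%:R).
Hypothesis Wpd : posdef W.
Hypothesis W1 : W + \sum_i n%:R^-1 *: (v i *m (v i)^T) = 1%:M.
Hypothesis vB : forall i, dotv (v i) (v i) <= B0.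
Hypotheses (r_gt0 : 0 < r) (rB : B0 * d%:R / k <= r ^+ 2) (r_small : 32 * r ^+ 2 <= 1).

Definition subsampled_mx (be : 'I_n -> bool) : 'M[R]_d :=
  W + \sum_i ((be i)%:R / k) *: (v i *m (v i)^T).

Let pr (_ : 'I_n) (b : bool) : R := bern (k / n%:R) b.
Let c (b : bool) : R := (b%:R - k / n%:R) / k.
(** One coordinate for the trace and d^2 for the entries: a single vector inequality then controls
    both quantities on which the determinant estimates depend. *)
Let J := ('I_1 + 'I_d * 'I_d)%type.
Let U i (j : J) : R :=
  match j with inl _ => dotv (v i) (v i) | inr ab => v i ab.1 0 * v i ab.2 0 end.

Definition deviation (Z : 'M[R]_d) : R := normf (fun j : J =>
  match j with inl _ => \tr (Z - 1%:M) | inr ab => (Z - 1%:M) ab.1 ab.2 end).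

Let n_gt0 : 0 < n%:R :> R. Proof. exact: lt_le_trans k_le. Qed.
Let k_ge0 : 0 <= k. Proof. exact: ltW. Qed.
Let n_ge0 : 0 <= n%:R :> R. Proof. exact: ltW. Qed.
Let r_ge0 : 0 <= r. Proof. exact: ltW. Qed.
Let B0_ge0 : 0 <= B0.
Proof.
have n0 : (0 < n)%N by rewrite -(ltr0n R).
exact: le_trans (dotv_ge0 _) (vB (Ordinal n0)).
Qed.
Let p01 : 0 <= k / n%:R <= 1.
Proof. by rewrite divr_ge0 //= ler_pdivrMr // mul1r. Qed.
Let pr_ge0 i b : 0 <= pr i b. Proof. exact: bern_ge0. Qed.
Let pr_sum1 i : \sum_b pr i b = 1. Proof. exact: bern_sum1. Qed.

Lemma subsampled_mx_posdef be : posdef (subsampled_mx be).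
Proof.
have [Wsym Wpos] := Wpd; split.
  rewrite /subsampled_mx linearD /= Wsym linear_sum /=; congr (_ + _).
  by apply: eq_bigr => i _; rewrite linearZ /= trmx_mul trmxK.
move=> u u0; rewrite /subsampled_mx mulmxDl dotvDr ltr_pwDl ?Wpos //.
rewrite mulmx_suml dotv_sumr; apply: sumr_ge0 => i _.
rewrite -scalemxAl dotvZr mulr_ge0 ?divr_ge0 ?ler0n //.
by rewrite mul_col_row_col dotvZr (dotvC u) -expr2 sqr_ge0.
Qed.

Lemma subsampled_mx_sub1 be :
  subsampled_mx be - 1%:M = \sum_i c (be i) *: (v i *m (v i)^T).
Proof.
rewrite -W1 /subsampled_mx opprD addrACA subrr add0r -sumrB.
apply: eq_bigr => i _; rewrite -scalerBl; congr (_ *: _).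
by rewrite /c; field; rewrite !gt_eqF.
Qed.

(** Traces in the whitening identity, W having a positive diagonal. Together with the bound B0 on
    each |v_i|^2, the mean of |v_i|^4 is at most B0 d, which explains the form of [rB]. *)
Lemma mean_sqnorm_le : \sum_i n%:R^-1 * dotv (v i) (v i) <= d%:R.
Proof.
have := congr1 mxtrace W1; rewrite mxtraceD mxtrace1 => <-.
have -> : \tr (\sum_i n%:R^-1 *: (v i *m (v i)^T)) =
    \sum_i n%:R^-1 * dotv (v i) (v i).
  rewrite linear_sum /=; apply: eq_bigr => i _.
  by rewrite linearZ /= mxtrace_mulC /dotv trace_mx11.
rewrite lerDr; apply: sumr_ge0 => i _.
have [_ /(_ (delta_mx i 0))] := Wpd.
have -> : dotv (delta_mx i 0) (W *m delta_mx i 0) = W i i.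
  rewrite -colE dotvE (bigD1 i) //= big1 => [|j ji]; last first.
    by rewrite mxE (negbTE ji) mul0r.
  by rewrite !mxE !eqxx mul1r addr0.
move=> h; apply/ltW/h/eqP => /colP/(_ i)/eqP.
by rewrite !mxE !eqxx oner_eq0.
Qed.

Let dotU i : dotf (U i) (U i) = 2 * dotv (v i) (v i) ^+ 2.
Proof.
rewrite /dotf big_sumType /= big_ord1.
rewrite -(pair_bigA _ (fun a b => (v i a 0 * v i b 0) * (v i a 0 * v i b 0))) /=.
rewrite mulr2n mulrDl mul1r expr2; congr (_ + _).
rewrite {1}dotvE mulr_suml; apply: eq_bigr => a _.
by rewrite dotvE mulr_sumr; apply: eq_bigr => b _; ring.
Qed.

Let mean_c i : \sum_b pr i b * c b = 0.
Proof. by rewrite big_bool /pr /bern /c /=; field; rewrite !gt_eqF. Qed.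

Let var_c i : \sum_b pr i b * c b ^+ 2 <= (k * n%:R)^-1.
Proof.
rewrite big_bool /pr /bern /c /=.
have -> : k / n%:R * ((1 - k / n%:R) / k) ^+ 2 + (1 - k / n%:R) * ((0 - k / n%:R) / k) ^+ 2
  = (k * n%:R)^-1 * (1 - k / n%:R) by field; rewrite !gt_eqF.
rewrite ler_piMr ?invr_ge0 ?mulr_ge0 ?k_ge0 ?n_ge0 //.
by move: p01 => /andP[p0 _]; lra.
Qed.

Let abs_c b : `|c b| <= k^-1.
Proof.
rewrite /c normrM normfV (gtr0_norm k_gt0) ler_piMl ?invr_ge0 ?k_ge0 //.
by move: p01 => /andP[p0 p1]; rewrite ler_norml; case: b => /=; lra.
Qed.

(** [pinelis] for the summands (2 / r) c_i U_i, of squared norm 8 c_i^2 |v_i|^4 / r^2. As |c_i|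
    |v_i|^2 <= B0 / k <= r^2, this is at most 8 r^2 <= 1/4. The variances add up to at most 8 (B0 d
    / k) / r^2 <= 8, whence the exponent 16; the factor 2 passes from exp to cosh. *)
Lemma deviation_exp_moment :
  prodE pr (fun be => expR (2 / r * deviation (subsampled_mx be))) <= 2 * expR 16.
Proof.
pose X i (b : bool) (j : J) := 2 / r * c b * U i j.
have rr : 0 < 2 / r by rewrite divr_gt0.
have dotX i b : normf (X i b) ^+ 2 = 8 / r ^+ 2 * c b ^+ 2 * dotv (v i) (v i) ^+ 2.
  rewrite sqr_normf.
  have -> : dotf (X i b) (X i b) = (2 / r * c b) ^+ 2 * dotf (U i) (U i).
    by rewrite /dotf mulr_sumr; apply: eq_bigr => j _; rewrite /X; ring.
  by rewrite dotU; field; rewrite gt_eqF.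
have B0k : B0 / k <= r ^+ 2.
  apply: le_trans rB; rewrite mulrAC ler_peMr ?ler1n //.
  by rewrite divr_ge0.
have cv i b : `|c b| * dotv (v i) (v i) <= r ^+ 2.
  apply: le_trans B0k; rewrite mulrC; apply: ler_pM; rewrite ?dotv_ge0 ?normr_ge0 //.
have devE be : 2 / r * deviation (subsampled_mx be) =
    normf (fun j => \sum_i X i (be i) j).
  rewrite -[2 / r]ger0_norm ?(ltW rr) // -sqrtr_sqr /deviation /normf -sqrtrM ?sqr_ge0 //.
  congr Num.sqrt; rewrite /dotf mulr_sumr; apply: eq_bigr => j _.
  have -> : \sum_i X i (be i) j = 2 / r * \sum_i c (be i) * U i j.
    by rewrite mulr_sumr; apply: eq_bigr => i _; rewrite /X; ring.
  rewrite subsampled_mx_sub1; set lhs := match j with inl _ => _ | inr _ => _ end.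
  have -> : lhs = \sum_i c (be i) * U i j.
    rewrite /lhs; case: (j) => [_|[a b]] /=.
      rewrite linear_sum /=; apply: eq_bigr => i _.
      by rewrite linearZ /= mxtrace_mulC /dotv trace_mx11.
    by rewrite summxE; apply: eq_bigr => i _; rewrite !mxE big_ord1 !mxE.
  by ring.
apply: (@le_trans _ _ (prodE pr (fun be => 2 * cosh (normf (fun j => \sum_i X i (be i) j))))).
  by apply: prodE_le => // be; rewrite devE exp_le_cosh.
rewrite prodEZ ler_wpM2l //; apply: le_trans (pinelis _ _ _ _) _ => //.
- move=> i j; rewrite /X (eq_bigr (fun b => 2 / r * U i j * (pr i b * c b))).
    by rewrite -mulr_sumr mean_c mulr0.
  by move=> b _; ring.
- move=> i b; rewrite -ler_sqr ?nnegrE ?normf_ge0 //.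
  rewrite dotX -[c b ^+ 2]real_normK ?num_real //.
  have h : (`|c b| * dotv (v i) (v i)) ^+ 2 <= (r ^+ 2) ^+ 2.
    by rewrite ler_sqr ?nnegrE ?sqr_ge0 ?mulr_ge0 ?dotv_ge0.
  have -> : 8 / r ^+ 2 * `|c b| ^+ 2 * dotv (v i) (v i) ^+ 2 =
    8 / r ^+ 2 * (`|c b| * dotv (v i) (v i)) ^+ 2 by ring.
  apply: le_trans (ler_wpM2l _ h) _; first by rewrite divr_ge0 ?sqr_ge0.
  have -> : 8 / r ^+ 2 * (r ^+ 2) ^+ 2 = 8 * r ^+ 2 by field; rewrite gt_eqF.
  have -> : 8 * r ^+ 2 = 4^-1 * (32 * r ^+ 2) by field.
  have -> : (1 / 2) ^+ 2 = 4^-1 * 1 :> R by field.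
  by rewrite ler_wpM2l.
rewrite ler_expR; suff : \sum_i \sum_b pr i b * normf (X i b) ^+ 2 <= 8 by lra.
apply: (@le_trans _ _ (\sum_i 8 / r ^+ 2 * (B0 / k) * (n%:R^-1 * dotv (v i) (v i)))).
  apply: ler_sum => i _; under eq_bigr do rewrite dotX.
  rewrite (eq_bigr (fun b => 8 / r ^+ 2 * dotv (v i) (v i) ^+ 2 * (pr i b * c b ^+ 2))).
    rewrite -mulr_sumr; apply: le_trans (ler_wpM2l _ (var_c i)) _.
      by rewrite mulr_ge0 ?sqr_ge0 // divr_ge0 ?sqr_ge0.
    have -> : 8 / r ^+ 2 * dotv (v i) (v i) ^+ 2 / (k * n%:R) =
      8 / r ^+ 2 * (dotv (v i) (v i) / k) * (n%:R^-1 * dotv (v i) (v i)).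
      by field; rewrite !gt_eqF.
    rewrite ler_wpM2r ?mulr_ge0 ?invr_ge0 ?dotv_ge0 //.
    rewrite ler_wpM2l ?divr_ge0 ?sqr_ge0 //.
    by rewrite ler_wpM2r ?invr_ge0.
  by move=> b _; ring.
rewrite -mulr_sumr; apply: le_trans (ler_wpM2l _ mean_sqnorm_le) _.
  by rewrite mulr_ge0 ?divr_ge0 ?sqr_ge0.
have -> : 8 / r ^+ 2 * (B0 / k) * d%:R = 8 / r ^+ 2 * (B0 * d%:R / k) by ring.
apply: le_trans (ler_wpM2l _ rB) _; first by rewrite divr_ge0 ?sqr_ge0.
by rewrite divfK // gt_eqF // exprn_gt0.
Qed.

Lemma deviation_ge_trace Z : `|\tr (Z - 1%:M)| <= deviation Z.
Proof.
rewrite -ler_sqr ?nnegrE ?normf_ge0 // real_normK ?num_real // sqr_normf.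
rewrite /dotf big_sumType /= big_ord1 -expr2 lerDl.
by apply: sumr_ge0 => ab _; rewrite -expr2 sqr_ge0.
Qed.

Lemma deviation_ge_frobenius (Z : 'M[R]_d) :
  normf (fun ij : 'I_d * 'I_d => (Z - 1%:M) ij.1 ij.2) <= deviation Z.
Proof.
rewrite -ler_sqr ?nnegrE ?normf_ge0 // !sqr_normf.
by rewrite /dotf big_sumType /= big_ord1 -expr2 lerDr sqr_ge0.
Qed.

Lemma one_sub_det_le_deviation be :
  1 - \det (subsampled_mx be) <= 3 * deviation (subsampled_mx be).
Proof.
have := one_sub_det_le (subsampled_mx_posdef be).
have := deviation_ge_trace (subsampled_mx be).
by have := deviation_ge_frobenius (subsampled_mx be); lra.
Qed.

Definition weighted_error (q : 'cV[R]_d) (Z : 'M[R]_d) : 'cV[R]_d :=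
  \det Z *: (invmx Z *m q - q).

Lemma weighted_error_le q be (G := deviation (subsampled_mx be)) :
  l2norm (weighted_error q (subsampled_mx be)) <= expR 1 * l2norm q * (G * expR G).
Proof.
apply: le_trans (det_inv_deviation (subsampled_mx_posdef be) q) _.
rewrite mulrAC [leRHS]mulrA ; set F := normf _.
have FG : F <= G := deviation_ge_frobenius _.
have tG := deviation_ge_trace (subsampled_mx be).
have e1 : expR (1 + \tr (subsampled_mx be - 1%:M)) <= expR 1 * expR G.
  by rewrite -expRD ler_expR lerD2l (le_trans (ler_norm _)).
have -> : expR 1 * l2norm q * G * expR G = expR 1 * expR G * l2norm q * G by ring.
apply: ler_pM; rewrite ?mulr_ge0 ?expR_ge0 ?l2norm_ge0 ?normf_ge0 //.
by rewrite ler_wpM2r ?l2norm_ge0.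
Qed.

(** The linear factor is traded for an exponential one: G <= P exp (G / P) with P = 2 p r. Then (G
    e^G)^(2p) <= P^(2p) exp (G / r + P G / r), and P <= 1 keeps the exponent below 2 G / r, the
    exponential moment at hand. *)
Lemma weighted_error_moment q p : (0 < p)%N -> 2 * p%:R * r <= 1 ->
  prodE pr (fun be => dotv (weighted_error q (subsampled_mx be))
    (weighted_error q (subsampled_mx be)) ^+ p)
  <= (expR 2 * dotv q q * (2 * p%:R * r) ^+ 2) ^+ p * (2 * expR 16).
Proof.
move=> p0 pr1; have pR : 0 < p%:R :> R by rewrite ltr0n.
have P0 : 0 < 2 * p%:R * r by rewrite !mulr_gt0.
apply: le_trans (ler_wpM2l _ deviation_exp_moment); last first.
  by rewrite exprn_ge0 // !mulr_ge0 ?expR_ge0 ?dotv_ge0 // ltW.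
rewrite -prodEZ; apply: prodE_le => // be; set G := deviation _.
have G0 : 0 <= G := normf_ge0 _.
rewrite -sqr_l2norm.
have := weighted_error_le q be; rewrite -/G => h.
have {}h : l2norm (weighted_error q (subsampled_mx be)) ^+ 2 <=
    (expR 1 * l2norm q * (G * expR G)) ^+ 2.
  by rewrite ler_sqr ?nnegrE ?mulr_ge0 ?expR_ge0 ?l2norm_ge0.
apply: (@le_trans _ _ (((expR 1 * l2norm q * (G * expR G)) ^+ 2) ^+ p)).
  by apply: lerXn2r; rewrite ?nnegrE ?sqr_ge0.
have -> : (expR 1 * l2norm q * (G * expR G)) ^+ 2 =
    expR 2 * dotv q q * (G * expR G) ^+ 2.
  by rewrite [LHS]exprMn exprMn -sqr_l2norm -expRM_natl mulr1.
rewrite [leLHS]exprMn [X in _ <= X * _]exprMn -[leRHS]mulrA.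
rewrite ler_wpM2l ?exprn_ge0 ?mulr_ge0 ?expR_ge0 ?dotv_ge0 //.
set P := 2 * p%:R * r in P0 pr1 *.
have GE : G <= P * expR (G / P).
  rewrite mulrC -ler_pdivrMr //; apply: le_trans (expR_ge1Dx _); lra.
have GE' : G * expR G <= P * expR (G / P + G).
  by rewrite expRD mulrA ler_wpM2r ?expR_ge0.
rewrite -!exprM; apply: (@le_trans _ _ ((P * expR (G / P + G)) ^+ (2 * p))).
  apply: lerXn2r; rewrite ?nnegrE // ?mulr_ge0 ?expR_ge0 //; exact: ltW.
rewrite exprMn ler_wpM2l ?exprn_ge0 ?(ltW P0) // -expRM_natl ler_expR.
have -> : (2 * p)%:R * (G / P + G) = G / r + P * (G / r).
  by rewrite natrM /P; field; rewrite !gt_eqF.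
have Gr : 0 <= G / r by rewrite divr_ge0.
have -> : 2 / r * G = G / r + 1 * (G / r) by field; rewrite gt_eqF.
by rewrite lerD2l ler_wpM2r.
Qed.

Lemma weighted_error_mean q a :
  prodE pr (fun be => weighted_error q (subsampled_mx be) a 0) = 0.
Proof.
have dE : prodE pr (fun be => \det (subsampled_mx be)) = 1.
  rewrite (@prodE_rank1_affine _ _ _ _ pr (fun _ b => b%:R / k) (fun M => \det M)) //.
    have -> : W + \sum_i (\sum_a0 pr i a0 * (a0%:R / k)) *: (v i *m (v i)^T) = 1%:M.
      rewrite -W1; congr (_ + _); apply: eq_bigr => i _; congr (_ *: _).
      by rewrite big_bool /pr /bern /=; field; rewrite !gt_eqF.
    exact: det1.
  exact: rank1_affine_det.
have cE i j : prodE pr (fun be => cofactor (subsampled_mx be) i j) = cofactor (1%:M : 'M[R]_d) i j.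
  rewrite (@prodE_rank1_affine _ _ _ _ pr (fun _ b => b%:R / k) (fun M => cofactor M i j)) //.
    have -> : W + \sum_i (\sum_a0 pr i a0 * (a0%:R / k)) *: (v i *m (v i)^T) = 1%:M.
      rewrite -W1; congr (_ + _); apply: eq_bigr => l _; congr (_ *: _).
      by rewrite big_bool /pr /bern /=; field; rewrite !gt_eqF.
    by [].
  exact: rank1_affine_cofactor.
have adj1 : \adj (1%:M : 'M[R]_d) = 1%:M.
  by have := mul_mx_adj (1%:M : 'M[R]_d); rewrite mul1mx det1.
have wE be : weighted_error q (subsampled_mx be) a 0 =
    \sum_b q b 0 * cofactor (subsampled_mx be) b a + - q a 0 * \det (subsampled_mx be).
  have Zu := posdef_unit (subsampled_mx_posdef be).
  have det0 : \det (subsampled_mx be) != 0 by move: Zu; rewrite unitmxE unitfE.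
  rewrite /weighted_error scalerBr scalemxAl /invmx Zu scalerA divff // scale1r.
  rewrite !mxE mulrC mulNr; congr (_ - _).
  by apply: eq_bigr => b _; rewrite mxE mulrC.
under eq_fun do rewrite wE.
rewrite prodED prodE_sum prodEZ dE mulr1.
have -> : \sum_b prodE pr (fun be => q b 0 * cofactor (subsampled_mx be) b a) =
    (\adj (1%:M : 'M[R]_d) *m q) a 0.
  by rewrite mxE; apply: eq_bigr => b _; rewrite prodEZ cE [\adj _ _ _]mxE mulrC.
by rewrite adj1 mul1mx subrr.
Qed.

(** The two exponentials are the two ways to fail: a total determinant below m / 2, and a large sum
    of errors. In T the leading exp 2 is the slack over the moment bound which, raised to the power
    p, gives exp (- 2 p) in Markov's inequality. *)
Lemma determinantal_averaging_concentration (m p : nat) (q : 'cV[R]_d)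
    (T := expR 2 * (4 * (4 * p%:R + 1) * m%:R *
      (expR 2 * dotv q q * (2 * p%:R * r) ^+ 2))) :
  (0 < m)%N -> (0 < p)%N -> 2 * p%:R * r <= 1 ->
  prodE (fun (_ : 'I_m) (be : {ffun 'I_n -> bool}) => \prod_i pr i (be i))
    (fun be => (~~ ((m%:R / 2 <= \sum_t \det (subsampled_mx (be t))) &&
       (dotv (\sum_t weighted_error q (subsampled_mx (be t)))
             (\sum_t weighted_error q (subsampled_mx (be t))) <= T)))%:R)
  <= 2 * expR 16 * (expR (- (3 * r)^-1) + expR (- (2 * p%:R))).
Proof.
move=> m0 p0 pr1; set wt := fun (_ : 'I_m) _ => _.
have mR : 0 < m%:R :> R by rewrite ltr0n.
have wt0 t be : 0 <= wt t be by exact: prodr_ge0.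
have wt1 t : \sum_be wt t be = 1 by exact: prodE_weight_sum1.
have M0 : 0 <= 2 * expR 16 :> R by rewrite mulr_ge0 ?expR_ge0.
set base := 4 * (4 * p%:R + 1) * m%:R * (expR 2 * dotv q q * (2 * p%:R * r) ^+ 2) in T *.
pose G (be : {ffun 'I_n -> bool}) := deviation (subsampled_mx be).
pose S (be : {ffun 'I_m -> {ffun 'I_n -> bool}}) :=
  \sum_t weighted_error q (subsampled_mx (be t)).
pose bad1 (be : {ffun 'I_m -> {ffun 'I_n -> bool}}) : bool :=
  \sum_t \det (subsampled_mx (be t)) < m%:R / 2.
pose bad2 be : bool := T < dotv (S be) (S be).
apply: (@le_trans _ _ (prodE wt (fun be => (bad1 be)%:R + (bad2 be)%:R))).
  apply: prodE_le => // be; rewrite negb_and -!ltNge -/(bad1 be) -/(bad2 be).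
  by case: (bad1 be); case: (bad2 be); rewrite ?addr0 ?add0r //= lerDl.
rewrite prodED mulrDr; apply: lerD.
  apply: (@le_trans _ _ (prodE wt (fun be => expR (- (3 * r)^-1) *
      \sum_t m%:R^-1 * expR (2 / r * G (be t))))).
    apply: prodE_le => // be; case: (boolP (bad1 be)) => [bad|_]; last first.
      rewrite mulr_ge0 ?expR_ge0 //; apply: sumr_ge0 => t _.
      by rewrite mulr_ge0 ?expR_ge0 ?invr_ge0 // ltW.
    rewrite expRN mulrC ler_pdivlMr ?expR_gt0 // mul1r.
    apply: exp_mean_ge.
    - by move=> _; rewrite invr_ge0 ltW.
    - by rewrite sumr_const card_ord -[_ *+ _]mulr_natr mulVf ?gt_eqF.
    have h : \sum_t (1 - \det (subsampled_mx (be t))) <= \sum_t 3 * G (be t).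
      by apply: ler_sum => t _; exact: one_sub_det_le_deviation.
    move: h bad; rewrite /bad1 sumrB sumr_const card_ord -mulr_sumr => h bad.
    have -> : \sum_t m%:R^-1 * (2 / r * G (be t)) = 2 / r / m%:R * \sum_t G (be t).
      by rewrite mulr_sumr; apply: eq_bigr => t _; ring.
    (* More than m / 2 is lost in total while copy t loses at most 3 G_t. At scale 2 / r the mean is
       thus at least (2 / r) / 6 = 1 / (3 r). *)
    have h2 : m%:R / 6 <= \sum_t G (be t) by lra.
    apply: le_trans (ler_wpM2l _ h2); last by rewrite !divr_ge0 // ltW.
    by rewrite le_eqVlt; apply/orP; left; apply/eqP; field; rewrite !gt_eqF.
  rewrite prodEZ prodE_sum mulrC ler_wpM2r ?expR_ge0 //.
  apply: (@le_trans _ _ (\sum_(t < m) m%:R^-1 * (2 * expR 16))).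
    apply: ler_sum => t _; rewrite prodEZ ler_wpM2l ?invr_ge0 ?(ltW mR) //.
    rewrite (prodE_coord wt1 t (fun be => expR (2 / r * G be))).
    exact: deviation_exp_moment.
  by rewrite sumr_const card_ord -[_ *+ _]mulr_natl mulrA divff ?gt_eqF // mul1r.
have T_ge0 : 0 <= T.
  rewrite /T /base; do 2 (rewrite mulr_ge0 ?expR_ge0 //).
  by rewrite !mulr_ge0 ?expR_ge0 ?dotv_ge0 ?sqr_ge0.
(* For q = 0 the threshold T vanishes and cannot be divided by, but all errors vanish as well. *)
have [q0|qN] := eqVneq q 0.
  apply: (@le_trans _ _ (prodE wt (fun=> 0))); last first.
    by rewrite (prodE_cst wt1) mulr_ge0 ?expR_ge0.
  apply: prodE_le => // be; rewrite /bad2 /S big1 => [|t _]; last first.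
    by rewrite /weighted_error q0 mulmx0 subr0 scaler0.
  by rewrite dotv0 ltNge T_ge0.
have qq : 0 < dotv q q.
  by rewrite lt_def dotv_ge0 andbT; apply: contra qN => /eqP/dotv_eq0->.
have base0 : 0 < base.
  have pR : 0 < p%:R :> R by rewrite ltr0n.
  by rewrite /base !mulr_gt0 ?expR_gt0 ?exprn_gt0 ?mulr_gt0 // addr_gt0 // mulr_gt0.
have T0 : 0 < T by rewrite mulr_gt0 ?expR_gt0.
apply: (@le_trans _ _ (prodE wt (fun be => (T ^+ p)^-1 * dotv (S be) (S be) ^+ p))).
  apply: prodE_le => // be; case: (boolP (bad2 be)) => [bad|_]; last first.
    by rewrite mulr_ge0 ?invr_ge0 ?exprn_ge0 ?dotv_ge0 // ltW.
  rewrite mulrC ler_pdivlMr ?exprn_gt0 // mul1r; apply: lerXn2r.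
  - by rewrite nnegrE ltW.
  - by rewrite nnegrE dotv_ge0.
  - exact: ltW.
rewrite prodEZ.
have momS : prodE wt (fun be => dotv (S be) (S be) ^+ p) <=
    (4 * (4 * p%:R + 1) * m%:R) ^+ p *
    ((expR 2 * dotv q q * (2 * p%:R * r) ^+ 2) ^+ p * (2 * expR 16)).
  have := @moment_sum_le R 'I_m 'I_d {ffun 'I_n -> bool} wt
    (fun _ be j => weighted_error q (subsampled_mx be) j 0) p
    ((expR 2 * dotv q q * (2 * p%:R * r) ^+ 2) ^+ p * (2 * expR 16)) wt0 wt1.
  rewrite card_ord => mom; apply: (le_trans _ (mom _ m0 _)).
  - apply: prodE_le => // be; rewrite dotv_dotf /S.
    by rewrite (_ : (fun i => _) =
      (fun j => \sum_t weighted_error q (subsampled_mx (be t)) j 0)) //;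
      apply/funext => j; rewrite summxE.
  - by move=> t j; exact: weighted_error_mean.
  - move=> t; under eq_bigr do rewrite -dotv_dotf.
    exact: weighted_error_moment.
apply: le_trans (ler_wpM2l _ momS) _; first by rewrite invr_ge0 exprn_ge0 // ltW.
rewrite [X in _ * X]mulrA -exprMn -/base /T exprMn -expRM_natl.
rewrite le_eqVlt; apply/orP; left; apply/eqP.
have bp : base ^+ p != 0 by rewrite gt_eqF // exprn_gt0.
have ep : expR (2 * p%:R) != 0 :> R by rewrite gt_eqF // expR_gt0.
by rewrite expRN (mulrC p%:R); field; rewrite bp ep.
Qed.

End SubsampledDeterminant.
(** * Gradients and Hessians *)

Section ConvexSecondDerivative.
Context {R : realType}.
Variable f : R -> R.
Hypothesis f_convex : convex_function setT (f : R -> R^o).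

Lemma convex_chord (a b c : R) : a < b -> b < c ->
  (c - a) * f b <= (c - b) * f a + (b - a) * f c.
Proof.
move=> ab bc; have ac : 0 < c - a by lra.
have t0 : 0 <= (c - b) / (c - a) by rewrite divr_ge0; lra.
have t1 : (c - b) / (c - a) <= 1 by rewrite ler_pdivrMr //; lra.
have : f ((c - b) / (c - a) * a + (1 - (c - b) / (c - a)) * c) <=
    (c - b) / (c - a) * f a + (1 - (c - b) / (c - a)) * f c.
  exact: (f_convex (Itv01 t0 t1) (mem_setT (a : R^o)) (mem_setT (c : R^o))).
have -> : (c - b) / (c - a) * a + (1 - (c - b) / (c - a)) * c = b.
  by field; rewrite gt_eqF.
rewrite -(ler_pM2l ac) => /le_trans; apply.
rewrite le_eqVlt; apply/orP; left; apply/eqP.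
by field; rewrite gt_eqF.
Qed.

Lemma near_dnbhs0_norm_lt (e : R) : 0 < e -> \forall h \near (0 : R)^', `|h| < e.
Proof.
move=> e0; apply/nbhs_ballP; exists e => //= z.
by rewrite /ball /= sub0r normrN.
Qed.

(** Difference quotients at either end, with a step h of either sign shorter than y - x, compare
    with the chord slope by the three-point inequality; the comparison passes to the limit. *)
Lemma convex_slope_derive (x y : R) : x < y -> derivable f x 1 -> derivable f y 1 ->
  derive1 f x <= (f y - f x) / (y - x) <= derive1 f y.
Proof.
move=> xy dx dy; have xy0 : 0 < y - x by lra.
rewrite !derive1E; apply/andP; split.
  apply: limr_le; first exact: dx.
  near=> h; rewrite /= [h *: 1]mulr1 -[_ *: _]/(_ * _).
  have h0 : h != 0 by near: h; exact: nbhs_dnbhs_neq.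
  have := ltgtP h 0.
  have hlt : `|h| < y - x by near: h; exact: near_dnbhs0_norm_lt.
  have {}hlt : - (y - x) < h < y - x by rewrite -ltr_norml.
  case=> [hs|hs|hs]; last by rewrite hs eqxx in h0.
    have H := @convex_chord (h + x) x y; rewrite -(ler_nM2l hs) mulVKf //.
    rewrite mulrA ler_pdivrMr //; have := H; rewrite gtrDr => /(_ hs xy); lra.
  have H := @convex_chord x (h + x) y; rewrite -(ler_pM2l hs) mulVKf //.
  rewrite mulrA ler_pdivlMr //.
  by have := H; rewrite ltrDr => /(_ hs) H'; have {}H' := H' ltac:(lra); lra.
apply: limr_ge; first exact: dy.
near=> h; rewrite /= [h *: 1]mulr1 -[_ *: _]/(_ * _).
have h0 : h != 0 by near: h; exact: nbhs_dnbhs_neq.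
have := ltgtP h 0.
have hlt : `|h| < y - x by near: h; exact: near_dnbhs0_norm_lt.
have {}hlt : - (y - x) < h < y - x by rewrite -ltr_norml.
case=> [hs|hs|hs]; last by rewrite hs eqxx in h0.
  have H := @convex_chord x (h + y) y; rewrite -(ler_nM2l hs) mulVKf //.
  rewrite mulrA ler_pdivlMr //.
  by have H' := H ltac:(lra) ltac:(lra); lra.
have H := @convex_chord x y (h + y); rewrite -(ler_pM2l hs) mulVKf //.
rewrite mulrA ler_pdivrMr //.
by have H' := H ltac:(lra) ltac:(lra); lra.
Unshelve. all: by end_near.
Qed.

Lemma convex_derive1n2_ge0 z : twice_derivable f -> 0 <= derive1n 2 f z.
Proof.
move=> df; rewrite /derive1n /= derive1E.
have mono x y : x < y -> derive1 f x <= derive1 f y.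
  move=> xy; have /andP[h1 h2] := convex_slope_derive xy (df x).1 (df y).1.
  exact: le_trans h1 h2.
apply: limr_ge; first exact: (df z).2.
near=> h; rewrite /= [h *: 1]mulr1 -[_ *: _]/(_ * _).
have h0 : h != 0 by near: h; exact: nbhs_dnbhs_neq.
have := ltgtP h 0; case=> [hs|hs|hs]; last by rewrite hs eqxx in h0.
  have m : derive1 f (h + z) <= derive1 f z by apply: mono; rewrite gtrDr.
  by rewrite mulr_le0 ?invr_le0 ?subr_le0 // ltW.
have m : derive1 f z <= derive1 f (h + z) by apply: mono; rewrite ltrDr.
by rewrite mulr_ge0 ?invr_ge0 ?subr_ge0 // ltW.
Unshelve. all: by end_near.
Qed.

End ConvexSecondDerivative.

Section LineDerivatives.
Context {R : realType} {d : nat}.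
Implicit Types (f : 'cV[R]_d -> R) (v a : 'cV[R]_d).

(** Gradients and Hessians here are built from directional derivatives, so one-variable calculus
    along lines is enough to compute them. *)
Lemma derive_line f v a : 'D_v f a = 'D_1 (fun h : R => f (h *: v + a)) 0.
Proof.
rewrite /derive.
suff -> : (fun h : R => h^-1 *: ((f \o shift a) (h *: v) - f a)) =
    (fun h : R => h^-1 *: (((fun h : R => f (h *: v + a)) \o shift 0) (h *: 1)
      - f ((0 : R) *: v + a))) by [].
by apply/funext => h /=; rewrite /shift /= [h *: 1]mulr1 addr0 scale0r add0r.
Qed.

Lemma is_derive_line f v a c :
  is_derive (0 : R) 1 (fun h : R => f (h *: v + a)) c -> 'D_v f a = c.
Proof. by move=> df; rewrite derive_line derive_val. Qed.

Lemma is_derive_affine_comp (phi : R -> R) (p q t : R) : derivable phi (t * p + q) 1 ->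
  is_derive t 1 (fun h : R => phi (h * p + q)) (derive1 phi (t * p + q) * p).
Proof.
move=> dphi.
have d1 : is_derive (t * p + q) 1 phi (derive1 phi (t * p + q)).
  by rewrite derive1E; exact: derivableP.
have d2 : is_derive t 1 (fun h : R => h * p + q) p.
  by apply: is_derive_eq; rewrite /GRing.scale /=; ring.
by have -> : (fun h : R => phi (h * p + q)) = phi \o (fun h : R => h * p + q) by []; exact: is_derive1_comp.
Qed.

(** Left general in c and phi in order to serve twice: with the losses for the gradient, and with
    their derivatives and coefficients c_i z.x_i for the Hessian. *)
Lemma is_derive_ridge n (x : 'I_n -> 'cV[R]_d) (c : 'I_n -> R) (phi : 'I_n -> R -> R) v a (t : R) :
  (forall i z, derivable (phi i) z 1) ->
  is_derive t 1 (fun h : R => \sum_(i < n) c i * phi i (dotv (h *: v + a) (x i)))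
    (\sum_(i < n) c i * (derive1 (phi i) (dotv (t *: v + a) (x i)) * dotv v (x i))).
Proof.
move=> dphi.
have -> : (fun h : R => \sum_(i < n) c i * phi i (dotv (h *: v + a) (x i))) =
    \sum_(i < n) (fun h : R => c i * phi i (h * dotv v (x i) + dotv a (x i))).
  apply/funext => h; rewrite fct_sumE; apply: eq_bigr => i _.
  by rewrite dotvDl dotvZl.
apply: is_derive_sum => i; rewrite dotvDl dotvZl.
have := is_derive_affine_comp (dphi i (t * dotv v (x i) + dotv a (x i))).
by move=> /(is_deriveZ (c i)).
Qed.

End LineDerivatives.

Section RegularizedLoss.
Context {R : realType} {n d : nat}.
Variables (x : 'I_n -> 'cV[R]_d) (ell : 'I_n -> R -> R) (lambda : R).
Variable c : 'I_n -> R.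
Hypothesis dell : forall i, twice_derivable (ell i).

(** Common form of the full loss (c_i = 1 / n) and of the subsampled ones (c_i = b_i / k). *)
Definition ridge_loss (w : 'cV[R]_d) : R :=
  \sum_(i < n) c i * ell i (dotv w (x i)) + lambda / 2 * l2norm w ^+ 2.

Definition ridge_gradient (w : 'cV[R]_d) : 'cV[R]_d :=
  \sum_(i < n) (c i * derive1 (ell i) (dotv w (x i))) *: x i + lambda *: w.

Definition ridge_hessian (w : 'cV[R]_d) : 'M[R]_d :=
  \sum_(i < n) (c i * derive1n 2 (ell i) (dotv w (x i))) *: (x i *m (x i)^T)
  + lambda%:M.

Lemma is_derive_ridge_loss v a (t : R) : is_derive t 1
  (fun h : R => ridge_loss (h *: v + a)) (dotv v (ridge_gradient (t *: v + a))).
Proof.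
have d1 := is_derive_ridge x c v a t (fun i z => (dell i z).1).
have d2 : is_derive t 1 (fun h : R => lambda / 2 * (h * h * dotv v v + 2 * h * dotv v a + dotv a a))
    (lambda * dotv v (t *: v + a)).
  by apply: is_derive_eq; rewrite dotvDr dotvZr /GRing.scale /=; field.
have -> : (fun h : R => ridge_loss (h *: v + a)) =
  (fun h : R => \sum_(i < n) c i * ell i (dotv (h *: v + a) (x i))) +
  (fun h : R => lambda / 2 * (h * h * dotv v v + 2 * h * dotv v a + dotv a a)).
  apply/funext => h; rewrite /ridge_loss fctE sqr_l2norm; congr (_ + _ * _).
  by rewrite dotvDl !dotvDr !dotvZl !dotvZr (dotvC a v); ring.
apply: is_derive_eq (is_deriveD d1 d2) _.
rewrite /ridge_gradient [RHS]dotvDr dotv_sumr dotvZr; congr (_ + _).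
by apply: eq_bigr => i _; rewrite dotvZr; ring.
Qed.

Lemma is_derive_ridge_gradient z v a (t : R) : is_derive t 1
  (fun h : R => dotv z (ridge_gradient (h *: v + a)))
  (dotv z (ridge_hessian (t *: v + a) *m v)).
Proof.
have d1 := is_derive_ridge x (fun i => c i * dotv z (x i)) v a t (fun i z => (dell i z).2).
have d2 : is_derive t 1 (fun h : R => lambda * (h * dotv z v + dotv z a)) (lambda * dotv z v).
  by apply: is_derive_eq; rewrite /GRing.scale /=; ring.
have -> : (fun h : R => dotv z (ridge_gradient (h *: v + a))) =
  (fun h : R => \sum_(i < n) c i * dotv z (x i) * derive1 (ell i) (dotv (h *: v + a) (x i))) +
  (fun h : R => lambda * (h * dotv z v + dotv z a)).
  apply/funext => h; rewrite /ridge_gradient fctE dotvDr dotv_sumr !dotvZr dotvDr dotvZr.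
  by congr (_ + _); apply: eq_bigr => i _; rewrite dotvZr; ring.
apply: is_derive_eq (is_deriveD d1 d2) _.
rewrite /ridge_hessian mulmxDl [RHS]dotvDr mul_scalar_mx dotvZr; congr (_ + _).
rewrite mulmx_suml dotv_sumr; apply: eq_bigr => i _.
rewrite -scalemxAl dotvZr -mulmxA.
have -> : (x i)^T *m v = (dotv (x i) v)%:M by apply/matrixP => j k; rewrite !ord1 [RHS]mxE.
rewrite mul_mx_scalar dotvZr (dotvC (x i) v) /=; ring.
Qed.

Lemma gradient_ridge w : gradient ridge_loss w = ridge_gradient w.
Proof.
apply/colP => i; rewrite mxE.
have := is_derive_ridge_loss (delta_mx i 0) w 0; rewrite scale0r add0r.
move=> /is_derive_line ->; rewrite dotvE (bigD1 i) //= mxE !eqxx mul1r big1 ?addr0 //.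
by move=> j ji; rewrite mxE (negbTE ji) mul0r.
Qed.

Lemma hessian_ridge w : hessian ridge_loss w = ridge_hessian w.
Proof.
apply/matrixP => i j; rewrite mxE.
have -> : (fun u => 'D_(delta_mx i 0) ridge_loss u) =
    (fun u => dotv (delta_mx i 0) (ridge_gradient u)).
  apply/funext => u; have := is_derive_ridge_loss (delta_mx i 0) u 0.
  by rewrite scale0r add0r => /is_derive_line.
have := is_derive_ridge_gradient (delta_mx i 0) (delta_mx j 0) w 0.
rewrite scale0r add0r => /(@is_derive_line _ _ (fun u => dotv (delta_mx i 0) (ridge_gradient u))) ->.
rewrite dotvE (bigD1 i) //= mxE !eqxx mul1r big1 ?addr0 => [|k ki]; last first.
  by rewrite mxE (negbTE ki) mul0r.
by rewrite -colE mxE.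
Qed.

Lemma ridge_hessian_sym w : (ridge_hessian w)^T = ridge_hessian w.
Proof.
rewrite /ridge_hessian linearD /= tr_scalar_mx linear_sum /=; congr (_ + _).
by apply: eq_bigr => i _; rewrite linearZ /= trmx_mul trmxK.
Qed.

(** Along the gradient g itself the derivative at the minimizer is |g|^2, and it vanishes at an
    interior minimum. *)
Lemma ridge_gradient_minimizer wstar :
  (forall u, ridge_loss wstar <= ridge_loss u) -> ridge_gradient wstar = 0.
Proof.
move=> wmin; apply: dotv_eq0; set g := ridge_gradient wstar.
have d1 := is_derive_ridge_loss g wstar 0.
have := @derive1_at_min R (fun h => ridge_loss (h *: g + wstar)) (-1) 1 0.
have -> : -1 <= 1 :> R by lra.
move=> /(_ isT) H; have {H}d2 : is_derive (0 : R) 1 (fun h : R => ridge_loss (h *: g + wstar)) 0.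
  apply: H.
  - by move=> t _; have [] := is_derive_ridge_loss g wstar t.
  - by rewrite in_itv /=; lra.
  - by move=> t _; rewrite scale0r add0r.
have := @derive_val _ _ _ _ _ _ _ d1; rewrite (@derive_val _ _ _ _ _ _ _ d2).
by rewrite scale0r add0r.
Qed.

(* For fixed z, monotonicity on [0, 1] of
   s |-> z.(grad (w* + s D) - s H D) + L/2 |z| |D|^2 (1 - s)^2. *)
Lemma newton_remainder_le (L : R) wstar w z :
  (forall u v, spectral_norm (ridge_hessian u - ridge_hessian v) <= L * l2norm (u - v)) ->
  ridge_gradient wstar = 0 ->
  dotv z (ridge_gradient w - ridge_hessian w *m (w - wstar)) <=
  L / 2 * l2norm z * l2norm (w - wstar) ^+ 2.
Proof.
move=> HL g0; set D := w - wstar.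
have wE : 1 *: D + wstar = w by rewrite scale1r subrK.
pose B := L * l2norm z * l2norm D ^+ 2.
pose chi (s : R) := dotv z (ridge_gradient (s *: D + wstar))
  - s * dotv z (ridge_hessian w *m D) + B / 2 * ((1 - s) * (1 - s)).
pose chi' (s : R) := dotv z (ridge_hessian (s *: D + wstar) *m D)
  - dotv z (ridge_hessian w *m D) - B * (1 - s).
have dchi (s : R) : is_derive s 1 chi (chi' s).
  have d1 := is_derive_ridge_gradient z D wstar s.
  have d2 : is_derive s 1 (fun s : R => - s * dotv z (ridge_hessian w *m D)
      + B / 2 * ((1 - s) * (1 - s))) (- dotv z (ridge_hessian w *m D) - B * (1 - s)).
    by apply: is_derive_eq; rewrite /GRing.scale /=; field.
  have -> : chi = (fun h : R => dotv z (ridge_gradient (h *: D + wstar))) +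
    (fun s : R => - s * dotv z (ridge_hessian w *m D) + B / 2 * ((1 - s) * (1 - s))).
    by apply/funext => h; rewrite /chi fctE; ring.
  by apply: is_derive_eq (is_deriveD d1 d2) _; rewrite /chi' addrA.
have : chi 1 <= chi 0.
  apply: (@ler0_derive1_nincr _ chi 0 1) => //.
  - move=> s; rewrite in_itv /= => /andP[s0 s1]; rewrite derive1E derive_val /chi'.
    rewrite subr_le0 -dotvBr -mulmxBl.
    apply: le_trans (ler_norm _) _; apply: le_trans (dotv_le _ _) _.
    rewrite /B -!mulrA [leRHS]mulrCA ler_wpM2l ?l2norm_ge0 //.
    apply: le_trans (spectral_norm_mul_le _ _) _.
    apply: le_trans (ler_wpM2r (l2norm_ge0 _) (HL _ _)) _.
    have -> : s *: D + wstar - w = (s - 1) *: D.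
      by rewrite scalerBl scale1r /D opprB addrA addrAC.
    rewrite l2normZ ler0_norm; last by rewrite subr_le0 ltW.
    by rewrite le_eqVlt; apply/orP; left; apply/eqP; ring.
  - by apply: continuous_subspaceT => y; apply: differentiable_continuous; exact/derivable1_diffP.
rewrite /chi wE scale0r add0r g0 dotv0 dotvBr /B; lra.
Qed.

End RegularizedLoss.
(** * Inexact Newton step *)

Section InexactNewton.
Context {R : realType} {d : nat}.

(* With phi(z) = z.Hz/2 - z.g, whose minimizer is the exact Newton direction P,
   the hypothesis on pt reads phi(pt) <= (1 - alpha^2) phi(P); compare with
   phi(D / (1 - alpha^2)). *)
Lemma inexact_newton_quadratic (H : 'M[R]_d) (g D pt : 'cV[R]_d) (al c : R) :
  posdef H -> 0 <= al < 1 ->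
  dotv (pt - invmx H *m g) (H *m (pt - invmx H *m g)) <=
    al * dotv (invmx H *m g) (H *m (invmx H *m g)) ->
  (forall z, dotv z (g - H *m D) <= c * l2norm z) ->
  dotv (D - pt) (H *m (D - pt)) <=
    2 * c * l2norm (D - pt) + al / (1 - al) * dotv D (H *m D).
Proof.
move=> Hpd /andP[al0 al1] hpt hc; have Hu := posdef_unit Hpd.
set P := invmx H *m g in hpt *.
have HP : H *m P = g by rewrite /P mulmxA mulmxV // mul1mx.
have sym u v : dotv u (H *m v) = dotv v (H *m u).
  by rewrite dotvC dotv_mull Hpd.1.
have pos u : 0 <= dotv u (H *m u).
  have [->|uN] := eqVneq u 0; first by rewrite mulmx0 dotv0.
  by apply/ltW/Hpd.2.
pose be := 1 - al; have be0 : 0 < be by rewrite subr_gt0.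
have e1 : dotv (pt - P) (H *m (pt - P)) =
    dotv pt (H *m pt) - 2 * dotv pt g + dotv P (H *m P).
  by rewrite mulmxBr !dotvBl !dotvBr (sym P pt) HP; ring.
(* Up to a positive factor this says that the quadratic model at D / (1 - alpha^2) is at least its
   value at its minimizer P. *)
have e2 := pos (D - be *: P).
have {}e2 : 0 <= dotv D (H *m D) - 2 * be * dotv D g + be ^+ 2 * dotv P (H *m P).
  move: e2; rewrite mulmxBr -!scalemxAr !dotvBl !dotvBr !dotvZl !dotvZr (sym P D) HP.
  by rewrite !(dotvC _ g) expr2; lra.
have e3 : dotv (D - pt) (H *m (D - pt)) =
    dotv D (H *m D) - 2 * dotv pt (H *m D) + dotv pt (H *m pt).
  by rewrite mulmxBr !dotvBl !dotvBr (sym D pt); ring.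
have e4 : dotv (pt - D) (g - H *m D) = dotv pt g - dotv pt (H *m D) - dotv D g + dotv D (H *m D).
  by rewrite !dotvBl !dotvBr; ring.
have e5 := hc (pt - D).
have nE : l2norm (pt - D) = l2norm (D - pt).
  by rewrite -opprB l2normN.
rewrite nE e4 in e5; rewrite e1 in hpt.
have e6 : dotv pt (H *m pt) - 2 * dotv pt g <=
    be^-1 * dotv D (H *m D) - 2 * dotv D g.
  have : 0 <= be^-1 * (dotv D (H *m D) - 2 * be * dotv D g + be ^+ 2 * dotv P (H *m P)).
    by rewrite mulr_ge0 // invr_ge0 ltW.
  have -> : be^-1 * (dotv D (H *m D) - 2 * be * dotv D g + be ^+ 2 * dotv P (H *m P)) =
    be^-1 * dotv D (H *m D) - 2 * dotv D g + be * dotv P (H *m P).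
    by field; rewrite gt_eqF.
  by move: hpt; rewrite /be; lra.
have -> : al / (1 - al) = be^-1 - 1 by rewrite /be; field; rewrite subr_eq0 gt_eqF.
by rewrite e3; lra.
Qed.

(** Either term of the quadratic bound may dominate; N is at most twice the larger. If it is L x
    y^2, then lambda_min x^2 <= N gives the second member of the maximum. Otherwise 2 al / (1 - al)
    <= eps^2, and passing to Euclidean norms costs the norms of H and of its inverse, that is the
    condition number. *)
Lemma inexact_newton (H : 'M[R]_d) (g D pt : 'cV[R]_d) (L al eps : R) :
  (0 < d)%N -> posdef H -> 0 <= al -> 0 <= eps -> 4 * al <= eps ^+ 2 -> eps <= 1 ->
  dotv (pt - invmx H *m g) (H *m (pt - invmx H *m g)) <=
    al * dotv (invmx H *m g) (H *m (invmx H *m g)) ->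
  (forall z, dotv z (g - H *m D) <= L / 2 * l2norm z * l2norm D ^+ 2) ->
  l2norm (D - pt) <= Num.max (eps * Num.sqrt (condition_number H) * l2norm D)
                             (2 * L / lambda_min H * l2norm D ^+ 2).
Proof.
move=> d0 Hpd al0 eps0 aleps eps1 hpt hL.
have eps2 : eps ^+ 2 <= 1 by rewrite expr_le1.
have al1 : al <= 1 / 4 by lra.
have al01 : 0 <= al < 1 by lra.
have [lam0 lamle] := posdef_lambda_min d0 Hpd.
have hc z : dotv z (g - H *m D) <= (L / 2 * l2norm D ^+ 2) * l2norm z.
  by apply: le_trans (hL z) _; rewrite mulrAC.
have := inexact_newton_quadratic Hpd al01 hpt hc.
set x := l2norm (D - pt); set y := l2norm D; set N := dotv (D - pt) _.
have x0 : 0 <= x := l2norm_ge0 _; have y0 : 0 <= y := l2norm_ge0 _.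
move=> main.
have NlamX : lambda_min H * x ^+ 2 <= N by rewrite sqr_l2norm lamle.
rewrite le_max; apply/orP.
have [case1|case2] := leP (al / (1 - al) * dotv D (H *m D)) (L * x * y ^+ 2).
  right; have [x00|xN] := eqVneq x 0.
    rewrite x00 (_ : _ * _ = 2 * (L * y ^+ 2) / lambda_min H); last by ring.
    rewrite divr_ge0 ?(ltW lam0) // mulr_ge0 //.
    (* L carries no sign hypothesis: that L y^2 >= 0 follows by adding the remainder bounds at D and
       at - D. *)
    have := hL D; have := hL (- D).
    rewrite dotvNl l2normN -/y.
    move=> h1 h2; have [->|yN] := eqVneq y 0; first by rewrite expr0n mulr0.
    have yp : 0 < y by rewrite lt_def yN.
    by rewrite -(pmulr_rge0 _ yp); lra.
  have xp : 0 < x by rewrite lt_def xN.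
  rewrite mulrAC ler_pdivlMr // -(ler_pM2r xp); move: main; lra.
left.
have a43 : al / (1 - al) <= 4 / 3 * al.
  by rewrite ler_pdivrMr; nra.
have DHD : dotv D (H *m D) <= spectral_norm H * y ^+ 2.
  by rewrite sqr_l2norm; exact: dotv_mul_le_spectral_norm.
have DHD0 : 0 <= dotv D (H *m D).
  have [->|uN] := eqVneq D 0; first by rewrite mulmx0 dotv0.
  by apply/ltW/Hpd.2.
have N2 : N <= eps ^+ 2 * (spectral_norm H * y ^+ 2).
  apply: (@le_trans _ _ (eps ^+ 2 * dotv D (H *m D))); last first.
    by rewrite ler_wpM2l ?sqr_ge0.
  have : al / (1 - al) * dotv D (H *m D) <= (eps ^+ 2 / 2) * dotv D (H *m D).
    by rewrite ler_wpM2r //; lra.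
  by move: main; lra.
have xN : x ^+ 2 <= spectral_norm (invmx H) * N.
  by rewrite sqr_l2norm; exact: dotv_le_spectral_norm_inv.
have s0 := spectral_norm_ge0 (invmx H); have s1 := spectral_norm_ge0 H.
have c0 : 0 <= condition_number H by rewrite mulr_ge0.
rewrite -ler_sqr ?nnegrE ?mulr_ge0 ?sqrtr_ge0 // !exprMn (sqr_sqrtr c0).
apply: le_trans xN _; apply: le_trans (ler_wpM2l s0 N2) _.
by rewrite /condition_number le_eqVlt; apply/orP; left; apply/eqP; ring.
Qed.

End InexactNewton.

(** * The averaged Newton direction in whitened coordinates *)

Section AveragedDirection.
Context {R : realType} {d : nat}.

Lemma unitmx_congruence (S A : 'M[R]_d) :
  S \in unitmx -> A \in unitmx -> S *m A *m S^T \in unitmx.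
Proof. by move=> Su Au; rewrite !unitmx_mul unitmx_tr Su Au. Qed.

(** Whitening multiplies every determinant by (det S)^2, which cancels in the weighted average, and
    turns the H-norm into the Euclidean one. The error becomes the sum of the weighted errors
    divided by the total determinant, and that divisor is at least m / 2. *)
Lemma averaged_newton_direction (m : nat) (S H : 'M[R]_d) (Hh : 'I_m -> 'M[R]_d)
    (g : 'cV[R]_d) (T al : R) (q := S *m g) (Z := fun t => S *m Hh t *m S^T)
    (pt := (\sum_t \det (Hh t))^-1 *: \sum_t \det (Hh t) *: (invmx (Hh t) *m g)) :
  S \in unitmx -> S *m H *m S^T = 1%:M -> S^T *m S = invmx H ->
  (forall t, Z t \in unitmx) -> (0 < m)%N ->
  m%:R / 2 <= \sum_t \det (Z t) ->
  dotv (\sum_t weighted_error q (Z t)) (\sum_t weighted_error q (Z t)) <= T ->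
  4 * T <= m%:R ^+ 2 * (al * dotv q q) ->
  dotv (pt - invmx H *m g) (H *m (pt - invmx H *m g)) <=
    al * dotv (invmx H *m g) (H *m (invmx H *m g)).
Proof.
move=> Su SHS SS Zu m0 hdet hT hal.
have mR : 0 < m%:R :> R by rewrite ltr0n.
have whiten y : dotv (S^T *m y) (H *m (S^T *m y)) = dotv y y.
  by rewrite dotv_mull trmxK !mulmxA SHS mul1mx.
have PE : invmx H *m g = S^T *m q by rewrite -SS mulmxA.
have STu : S^T \in unitmx by rewrite unitmx_tr.
have Hhu t : Hh t \in unitmx.
  by have := Zu t; rewrite /Z !unitmx_mul => /andP[/andP[]].
have phE t : invmx (Hh t) *m g = S^T *m (invmx (Z t) *m q).
  have e : Hh t *m (S^T *m (invmx (Z t) *m q)) = g.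
    have : S *m (Hh t *m (S^T *m (invmx (Z t) *m q))) = S *m g.
      by rewrite !mulmxA -/(Z t) mulmxV // mul1mx.
    by move=> /(congr1 (mulmx (invmx S))); rewrite !mulKmx.
  by rewrite -[in LHS]e mulKmx.
pose sg := \det S ^+ 2.
have sg0 : sg != 0 by rewrite expf_neq0 //; move: Su; rewrite unitmxE unitfE.
have detE t : \det (Hh t) = sg^-1 * \det (Z t).
  rewrite /Z !det_mulmx det_tr.
  have -> : \det S * \det (Hh t) * \det S = sg * \det (Hh t) by rewrite /sg; ring.
  by rewrite mulKf.
set A := \sum_t \det (Z t) in hdet *.
have A0 : 0 < A by apply: lt_le_trans hdet; rewrite divr_gt0.
set Y := \sum_t weighted_error q (Z t) in hT *.
have ptE : pt - invmx H *m g = S^T *m (A^-1 *: Y).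
  have -> : pt = S^T *m (A^-1 *: \sum_t \det (Z t) *: (invmx (Z t) *m q)).
    rewrite /pt; under [X in X^-1]eq_bigr do rewrite detE.
    under [X in _ *: X]eq_bigr do rewrite detE phE -scalerA.
    rewrite -mulr_sumr -/A -scaler_sumr scalerA invfM invrK mulrAC divff // mul1r.
    rewrite -scalemxAr mulmx_sumr; congr (_ *: _).
    by apply: eq_bigr => t _; rewrite scalemxAr.
  rewrite PE -mulmxBr; congr (_ *m _).
  have -> : Y = \sum_t \det (Z t) *: (invmx (Z t) *m q) - A *: q.
    rewrite /Y /A scaler_suml -sumrB; apply: eq_bigr => t _.
    by rewrite /weighted_error scalerBr.
  by rewrite scalerBr scalerA mulVf ?gt_eqF // scale1r.
rewrite ptE PE !whiten dotvZl dotvZr mulrA -invfM mulrC ler_pdivrMr ?mulr_gt0 //.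
have T0 : 0 <= T by apply: le_trans hT; exact: dotv_ge0.
apply: le_trans hT _.
have qq : 0 <= al * dotv q q.
  rewrite -(pmulr_rge0 _ (exprn_gt0 2 mR)); apply: le_trans hal.
  by rewrite mulr_ge0.
have A2 : m%:R ^+ 2 <= 4 * (A * A).
  have : (m%:R / 2) * (m%:R / 2) <= A * A by apply: ler_pM => //; rewrite divr_ge0 ?ltW.
  by rewrite expr2; lra.
have := ler_wpM2r qq A2; lra.
Qed.

End AveragedDirection.

(** * Choice of the moment order and of the constants *)

Section SampleSize.
Context {R : realType}.

(** Here e is exp 2 and Q is |q|^2. The 256 is 4^4: from the divisor m / 2, from the moment
    inequality, from (2 p r)^2 and from alpha^2 = eta^2 / (4 m). *)
Lemma error_budget (m : nat) (e p r eta Q : R) : (0 < m)%N -> 0 <= Q ->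
  256 * (e * e) * (4 * p + 1) * p ^+ 2 * r ^+ 2 <= eta ^+ 2 ->
  4 * (e * (4 * (4 * p + 1) * m%:R * (e * Q * (2 * p * r) ^+ 2))) <=
  m%:R ^+ 2 * (eta ^+ 2 / (4 * m%:R) * Q).
Proof.
move=> m0 Q0 h; have mR : 0 < m%:R :> R by rewrite ltr0n.
have Qm : 0 <= Q * m%:R / 4 by rewrite divr_ge0 // mulr_ge0 // ltW.
have := ler_wpM2r Qm h.
have -> : m%:R ^+ 2 * (eta ^+ 2 / (4 * m%:R) * Q) = eta ^+ 2 * (Q * m%:R / 4).
  by field; rewrite gt_eqF.
by apply: le_trans; rewrite le_eqVlt; apply/orP; left; apply/eqP; field.
Qed.

Lemma sample_size_ratio (C k eta mu d l : R) :
  0 < C -> 0 < k -> 0 < eta -> 0 < l ->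
  C * eta ^- 2 * mu * d ^+ 2 * l ^+ 3 <= k ->
  mu * d * d / k <= eta ^+ 2 / (C * l ^+ 3).
Proof.
move=> C0 k0 et0 l0 Ck.
rewrite ler_pdivrMr // [leRHS]mulrAC ler_pdivlMr ?mulr_gt0 ?exprn_gt0 //.
have et2 : 0 < eta ^+ 2 by rewrite exprn_gt0.
have := ler_wpM2l (ltW et2) Ck; apply: le_trans.
by rewrite le_eqVlt; apply/orP; left; apply/eqP; field; rewrite gt_eqF.
Qed.

Lemma indicator_contra (b c : bool) : (b -> c) -> (~~ c)%:R <= (~~ b)%:R :> R.
Proof. by case: b; case: c => //= h; have := h isT. Qed.

Lemma expR2_ge4 : 4 <= expR 2 :> R.
Proof.
have e1 : 2 <= expR 1 :> R by have := @expR_ge1Dx R 1; lra.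
by rewrite -[2]/(1 + 1) expRD; nra.
Qed.

Lemma expR_half_le2 : expR (2^-1) <= 2 :> R.
Proof.
have := @expR_ge1Dx R (- 2^-1); rewrite expRN => h.
have e0 : 0 < expR (2^-1) :> R := expR_gt0 _.
have : (1 + - 2^-1) * expR (2^-1) <= 1 :> R by rewrite -ler_pdivlMr // mul1r.
by lra.
Qed.

(* p = floor (20 l) + 1 lies between 20 l and 22 l and 120 l r <= 1, so both
   exponentials are at most exp (- 40 l), where exp (- l) = delta / d. *)
Lemma sample_size_parameters (C : R) (d : nat) (delta eta : R)
    (l := ln (d%:R / delta)) (r := Num.sqrt (eta ^+ 2 / (C * l ^+ 3))) :
  2 * 120 ^+ 2 <= C -> 1280 * 22 ^+ 3 * (expR 2 * expR 2) <= C ->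
  (0 < d)%N -> 0 < delta < 1 -> 0 < eta < 1 -> 2 <= d%:R / delta ->
  0 < l /\ 0 < r /\ r ^+ 2 = eta ^+ 2 / (C * l ^+ 3) /\
  32 * r ^+ 2 <= 1 /\ exists p : nat, [/\ (0 < p)%N, 2 * p%:R * r <= 1,
    256 * (expR 2 * expR 2) * (4 * p%:R + 1) * p%:R ^+ 2 * r ^+ 2 <= eta ^+ 2 &
    2 * expR 16 * (expR (- (3 * r)^-1) + expR (- (2 * p%:R))) <= delta].
Proof.
move=> C1 C2 d0 /andP[de0 de1] /andP[et0 et1] dd.
have C0 : 0 < C.
  apply: lt_le_trans C1; apply: mulr_gt0; first exact: ltr0n.
  by apply: exprn_gt0; exact: ltr0n.
have ddp : 0 < d%:R / delta by apply: lt_le_trans dd.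
(* d / delta is at least 2, hence at least exp (1/2); this lets powers of l absorb additive
   constants. *)
have l12 : 1 / 2 <= l.
  rewrite /l -ler_expR lnK ?posrE //; apply: le_trans dd.
  by rewrite mul1r; exact: expR_half_le2.
have l0 : 0 < l by lra.
have l3 : 0 < l ^+ 3 by rewrite exprn_gt0.
have Cl3 : 0 < C * l ^+ 3 by rewrite mulr_gt0.
have rsq0 : 0 < eta ^+ 2 / (C * l ^+ 3) by rewrite divr_gt0 ?exprn_gt0.
have r0 : 0 < r by rewrite sqrtr_gt0.
have rE : r ^+ 2 = eta ^+ 2 / (C * l ^+ 3) by rewrite sqr_sqrtr // ltW.
have rE' : C * l ^+ 3 * r ^+ 2 = eta ^+ 2 by rewrite rE mulrC divfK // gt_eqF.
have eta2 : eta ^+ 2 <= 1 by rewrite expr_le1 // ltW.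
have r120 : 120 * (l * r) <= 1.
  have lr0 : 0 <= l * r by rewrite mulr_ge0 // ltW.
  have P : 0 <= 120 * (l * r) by apply: mulr_ge0; first exact: ler0n.
  rewrite -(expr_le1 (ltn0Sn 1) P) [_ ^+ 2]exprMn.
  apply: le_trans eta2; rewrite -rE'.
  have -> : C * l ^+ 3 * r ^+ 2 = C * l * (l * r) ^+ 2 by ring.
  apply: ler_wpM2r; first exact: sqr_ge0.
  apply: (@le_trans _ _ (2 * 120 ^+ 2 * l)); last by apply: ler_wpM2r; first exact: ltW.
  rewrite mulrAC -[leLHS]mul1r; apply: ler_wpM2r; last by lra.
  by apply: exprn_ge0; exact: ler0n.
have r60 : 60 * r <= 1.
  have : (1 / 2) * r <= l * r by apply: ler_wpM2r; first exact: ltW.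
  lra.
split=> //; split=> //; split=> //; split.
  have : r ^+ 2 <= r / 60.
    by rewrite expr2; apply: ler_wpM2l; [exact: ltW | lra].
  lra.
pose p := (Num.truncn (20 * l)).+1.
have l20 : 0 <= 20 * l by lra.
have p20 : 20 * l <= p%:R by apply/ltW; rewrite /p truncnS_gt.
have p22 : p%:R <= 22 * l.
  rewrite /p -natr1; have := @truncn_le R (20 * l); rewrite l20.
  move=> h; lra.
have p1 : 1 <= p%:R :> R by rewrite ler1n.
exists p; split => //.
- have : p%:R * r <= 22 * l * r by apply: ler_wpM2r; first exact: ltW.
  have : 0 <= l * r by rewrite mulr_ge0 // ltW.
  lra.
- rewrite -rE'; apply: ler_wpM2r; first exact: sqr_ge0.
  apply: (@le_trans _ _ (1280 * 22 ^+ 3 * (expR 2 * expR 2) * l ^+ 3)); last first.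
    by apply: ler_wpM2r; first exact: ltW.
  (* Since p >= 1, 4 p + 1 <= 5 p, and p <= u: hence 256 times 5, that is 1280, and the cube of
     22. *)
  set EE := expR 2 * expR 2; pose u := 22 * l.
  have -> : 1280 * 22 ^+ 3 * EE * l ^+ 3 = 256 * EE * (5 * u * u ^+ 2).
    by rewrite /u; ring.
  rewrite -[leLHS]mulrA; apply: ler_wpM2l.
    by apply: mulr_ge0; [exact: ler0n | rewrite /EE mulr_ge0 ?expR_ge0].
  have u1 : 0 <= u by apply: le_trans p22; exact: ler0n.
  apply: ler_pM; [by lra | exact: sqr_ge0 | by rewrite /u; lra |].
  by rewrite /u ler_sqr ?nnegrE.
(* One factor exp (- l) = delta / d provides delta; the other 39 give exp (- 19), as l >= 1/2, to
   beat the constant 4 exp 16. *)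
have e40 : expR (- (40 * l)) <= expR (- 19) * delta.
  have -> : - (40 * l) = - (39 * l) + - l by ring.
  rewrite expRD; apply: ler_pM; [exact: expR_ge0|exact: expR_ge0| |].
    by rewrite ler_expR; lra.
  rewrite expRN /l lnK ?posrE // invf_div ler_pdivrMr ?ltr0n //.
  by rewrite ler_peMr ?ler1n // ltW.
have b1 : expR (- (3 * r)^-1) <= expR (- (40 * l)).
  rewrite ler_expR lerN2 -[leRHS]mul1r ler_pdivlMr; first by lra.
  by rewrite mulr_gt0.
have b2 : expR (- (2 * p%:R)) <= expR (- (40 * l)) by rewrite ler_expR lerN2; lra.
apply: (@le_trans _ _ (2 * expR 16 * (2 * (expR (- 19) * delta)))).
  apply: ler_wpM2l; last by lra.
  by apply: mulr_ge0; [exact: ler0n | exact: expR_ge0].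
have -> : 2 * expR 16 * (2 * (expR (- 19) * delta)) = 4 * (expR 16 * expR (- 19)) * delta.
  by ring.
rewrite -expRD -[leRHS]mul1r; apply: ler_wpM2r; first exact: ltW.
apply: (@le_trans _ _ (expR 2 * expR (16 + - 19))).
  by apply: ler_wpM2r; [exact: expR_ge0 | exact: expR2_ge4].
rewrite -expRD; apply: (@le_trans _ _ (expR 0)); last by rewrite expR0.
by rewrite ler_expR; lra.
Qed.

End SampleSize.

(** * Whitened Hessians and the final assembly *)

Section SubsampledNewton.
Context {R : realType} {n d : nat}.
Variables (x : 'I_n -> 'cV[R]_d) (ell : 'I_n -> R -> R) (lambda : R).

Lemma loss_ridge : loss x ell lambda = ridge_loss x ell lambda (fun=> n%:R^-1).
Proof. by apply/funext => w; rewrite /loss /ridge_loss mulr_sumr. Qed.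

Lemma subsampled_loss_ridge k b : subsampled_loss x ell lambda k b =
  ridge_loss x ell lambda (fun i => (b i)%:R / k).
Proof.
apply/funext => w; rewrite /subsampled_loss /ridge_loss mulr_sumr; congr (_ + _).
by apply: eq_bigr => i _; rewrite mulrA [k^-1 * _]mulrC.
Qed.

Hypothesis lambda_gt0 : 0 < lambda.
Hypothesis ell_convex : forall i z, 0 <= derive1n 2 (ell i) z.

Lemma ridge_hessian_posdef (c : 'I_n -> R) w : (forall i, 0 <= c i) ->
  posdef (ridge_hessian x ell lambda c w).
Proof.
move=> c0; split; first exact: ridge_hessian_sym.
move=> u uN; rewrite /ridge_hessian mulmxDl dotvDr mul_scalar_mx dotvZr.
rewrite ltr_wpDl ?mulr_gt0 //; last first.
  by rewrite lt_def dotv_ge0 andbT; apply: contra uN => /eqP/dotv_eq0->.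
rewrite mulmx_suml dotv_sumr; apply: sumr_ge0 => i _.
rewrite -scalemxAl dotvZr mul_col_row_col dotvZr (dotvC u) -expr2.
by apply: mulr_ge0; [exact: mulr_ge0 | exact: sqr_ge0].
Qed.

Variables (S : 'M[R]_d) (w : 'cV[R]_d).

(** The square root of the second derivative is put into the vector, so that each data term of the
    whitened Hessian is a plain v v^T. *)
Definition whitened_sample i : 'cV[R]_d :=
  Num.sqrt (derive1n 2 (ell i) (dotv w (x i))) *: (S *m x i).

Lemma whitened_ridge_hessian (c : 'I_n -> R) :
  S *m ridge_hessian x ell lambda c w *m S^T =
  lambda *: (S *m S^T) + \sum_i c i *: (whitened_sample i *m (whitened_sample i)^T).
Proof.
rewrite /ridge_hessian mulmxDr mulmxDl addrC mul_mx_scalar -scalemxAl; congr (_ + _).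
rewrite mulmx_sumr mulmx_suml; apply: eq_bigr => i _.
have -> : whitened_sample i *m (whitened_sample i)^T =
    derive1n 2 (ell i) (dotv w (x i)) *: (S *m x i *m (x i)^T *m S^T).
  have := ell_convex i (dotv w (x i)); rewrite /whitened_sample.
  move: (derive1n 2 _ _) => l2 l20.
  rewrite linearZ /= -scalemxAl -scalemxAr scalerA -expr2 sqr_sqrtr //.
  by rewrite trmx_mul !mulmxA.
by rewrite -scalemxAr -scalemxAl scalerA !mulmxA.
Qed.

(** These are the quantities whose maximum is mu d. *)
Lemma whitened_sample_sqnorm i (H : 'M[R]_d) : S^T *m S = invmx H ->
  dotv (whitened_sample i) (whitened_sample i) =
  derive1n 2 (ell i) (dotv w (x i)) * wnorm (invmx H) (x i) ^+ 2.
Proof.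
move=> SS; rewrite /whitened_sample dotvZl dotvZr mulrA -expr2 sqr_sqrtr //.
have e : dotv (S *m x i) (S *m x i) = ((x i)^T *m invmx H *m x i) 0 0.
  by rewrite -SS dotv_mull /dotv !mulmxA.
by rewrite /wnorm sqr_sqrtr -e ?dotv_ge0.
Qed.

Lemma whitened_regularizer_posdef : S \in unitmx -> posdef (lambda *: (S *m S^T)).
Proof.
move=> Su; split; first by rewrite linearZ /= trmx_mul trmxK.
move=> u uN; rewrite -scalemxAl dotvZr mulr_gt0 // -mulmxA.
have -> : dotv u (S *m (S^T *m u)) = dotv (S^T *m u) (S^T *m u).
  by rewrite dotv_mull trmxK.
rewrite lt_def dotv_ge0 andbT; apply: contra uN => /eqP/dotv_eq0 e.
have STu : S^T \in unitmx by rewrite unitmx_tr.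
by rewrite -[u](mulKmx STu) e mulmx0.
Qed.

End SubsampledNewton.

Theorem corollary6 (R : realType) :
  exists C : R, 0 < C /\
  forall (n d m : nat) (x : 'I_n -> 'cV[R]_d) (ell : 'I_n -> R -> R)
    (lambda k L : R) (wstar : 'cV[R]_d)
    (dT : measure_display) (T : measurableType dT) (P : probability T R)
    (b : 'I_m -> 'I_n -> {RV P >-> bool})
    (w : 'cV[R]_d) (delta eta : R),
  let Lo := loss x ell lambda in
  let Lhat t om := subsampled_loss x ell lambda k (fun i => b t i om) in
  let H := hessian Lo w in
  let a t om := \det (hessian (Lhat t om) w) in
  let phat t om := invmx (hessian (Lhat t om) w) *m gradient Lo w in
  let mu := d%:R^-1 *
    \big[Num.max/0]_(i < n)
      (derive1n 2 (ell i) (dotv w (x i)) * wnorm (invmx H) (x i) ^+ 2) in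
  let wtilde om :=
    w - (\sum_(t < m) a t om)^-1 *: (\sum_(t < m) a t om *: phat t om) in
  let kappa := condition_number H in
  (0 < d)%N -> (0 < m)%N -> 0 < lambda -> 0 < k <= n%:R ->
  (forall i, convex_function setT (ell i)) ->
  (forall i, twice_derivable (ell i)) ->
  (forall i, smooth (ell i)) ->
  (forall u, Lo wstar <= Lo u) ->
  (forall u v,
    spectral_norm (hessian Lo u - hessian Lo v) <= L * l2norm (u - v)) ->
  (forall t i, distribution P (b t i) = bernoulli_prob (k / n%:R)) ->
  mutually_independent (fun ti : 'I_m * 'I_n => b ti.1 ti.2) ->
  0 < delta < 1 -> 0 < eta < 1 ->
  2 <= d%:R / delta ->
  C * eta ^- 2 * mu * d%:R ^+ 2 * ln (d%:R / delta) ^+ 3 <= k ->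
  ((1 - delta)%:E <=
    P [set om | l2norm (wtilde om - wstar) <=
        Num.max
          (eta / Num.sqrt m%:R * Num.sqrt kappa * l2norm (w - wstar))
          (2 * L / lambda_min H * l2norm (w - wstar) ^+ 2)]%R)%E.
Proof.
pose C : R := 1280 * 22 ^+ 3 * (expR 2 * expR 2) + 2 * 120 ^+ 2.
have E0 : 0 <= 1280 * 22 ^+ 3 * (expR 2 * expR 2) :> R.
  apply: mulr_ge0; last by rewrite mulr_ge0 ?expR_ge0.
  by apply: mulr_ge0; [exact: ler0n | apply: exprn_ge0; exact: ler0n].
have C120 : 0 < 2 * 120 ^+ 2 :> R.
  by apply: mulr_gt0; [exact: ltr0n | apply: exprn_gt0; exact: ltr0n].
have C1 : 2 * 120 ^+ 2 <= C by rewrite lerDr.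
have C2 : 1280 * 22 ^+ 3 * (expR 2 * expR 2) <= C by rewrite lerDl ltW.
have C0 : 0 < C by exact: lt_le_trans C1.
(* C is a sum so as to dominate both constants; it is made opaque, only the bounds being kept. *)
move: (C) C1 C2 C0 => {E0 C120}C C1 C2 C0.
exists C; split=> //.
move=> n d m x ell lambda k L wstar dT T P b w delta eta Lo Lhat H a phat mu wtilde kappa.
move=> d0 m0 lam0 /andP[k0 kn] ellconv elltd _ wmin HL dist indep de01 et01 dd Ck.
have ell2 i z : 0 <= derive1n 2 (ell i) z by exact: convex_derive1n2_ge0.
have n0 : 0 < n%:R :> R by apply: lt_le_trans kn.
have mR : 0 < m%:R :> R by rewrite ltr0n.
have dR : 0 < d%:R :> R by rewrite ltr0n.
pose c0 (_ : 'I_n) : R := n%:R^-1.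
pose Hr c := ridge_hessian x ell lambda c w.
have hessE u : hessian Lo u = ridge_hessian x ell lambda c0 u.
  by rewrite /Lo loss_ridge hessian_ridge.
have gradE u : gradient Lo u = ridge_gradient x ell lambda c0 u.
  by rewrite /Lo loss_ridge gradient_ridge.
have HE : H = Hr c0 by rewrite /H hessE.
have hessLhat t om : hessian (Lhat t om) w = Hr (fun i => (b t i om)%:R / k).
  by rewrite /Lhat subsampled_loss_ridge hessian_ridge.
have Hpd : posdef H by rewrite HE; apply: ridge_hessian_posdef => // i; rewrite invr_ge0 ltW.
have [S [Su SHS SS]] := posdef_whitening Hpd.
set g := gradient Lo w in phat wtilde *.
have g0 : ridge_gradient x ell lambda c0 wstar = 0.
  by apply: ridge_gradient_minimizer => // u; have := wmin u; rewrite /Lo loss_ridge.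
pose v := whitened_sample x ell S w.
pose W := lambda *: (S *m S^T).
have Wpd : posdef W by exact: whitened_regularizer_posdef.
have W1 : W + \sum_i n%:R^-1 *: (v i *m (v i)^T) = 1%:M.
  by rewrite -SHS HE /Hr whitened_ridge_hessian.
(* So B0 = mu d, and B0 d / k is the ratio mu d^2 / k governed by the sample size. *)
have vB i : dotv (v i) (v i) <= mu * d%:R.
  have -> : dotv (v i) (v i) =
      derive1n 2 (ell i) (dotv w (x i)) * wnorm (invmx H) (x i) ^+ 2.
    exact: whitened_sample_sqnorm.
  rewrite /mu mulrAC mulVf ?gt_eqF // mul1r.
  exact: (le_bigmax 0 (fun i => derive1n 2 (ell i) (dotv w (x i)) *
    wnorm (invmx H) (x i) ^+ 2) i).
have Hhp (be : {ffun 'I_n -> bool}) : posdef (Hr (fun i => (be i)%:R / k)).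
  by apply: ridge_hessian_posdef => // i; rewrite divr_ge0 ?ler0n // ltW.
have sm : 0 < Num.sqrt m%:R :> R by rewrite sqrtr_gt0.
have et0 : 0 < eta by case/andP: et01.
have et1 : eta < 1 by case/andP: et01.
(* This is alpha^2; with eps = eta / sqrt m the condition 4 alpha^2 <= eps^2 of [inexact_newton] is
   an equality. *)
have al0 : 0 <= eta ^+ 2 / (4 * m%:R) by rewrite divr_ge0 ?sqr_ge0 // mulr_ge0 // ltW.
have eps0 : 0 <= eta / Num.sqrt m%:R by rewrite divr_ge0 // ltW.
have eps1 : eta / Num.sqrt m%:R <= 1.
  have m1 : 1 <= Num.sqrt m%:R :> R by rewrite -[leLHS]sqrtr1 ler_sqrt ?ler1n.
  by rewrite ler_pdivrMr // mul1r; exact: le_trans (ltW et1) m1.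
have aleps : 4 * (eta ^+ 2 / (4 * m%:R)) <= (eta / Num.sqrt m%:R) ^+ 2.
  rewrite expr_div_n sqr_sqrtr ?(ltW mR) // le_eqVlt; apply/orP; left; apply/eqP.
  by field; rewrite gt_eqF.
have newton_rem z : dotv z (g - H *m (w - wstar)) <=
    L / 2 * l2norm z * l2norm (w - wstar) ^+ 2.
  rewrite /g gradE HE; apply: newton_remainder_le => // u u'.
  by rewrite -!hessE.
have qq0 : 0 <= dotv (S *m g) (S *m g) := dotv_ge0 _.
pose q := S *m g.
pose Z (be : {ffun 'I_n -> bool}) := subsampled_mx W v k be.
pose Hh (be : {ffun 'I_n -> bool}) := Hr (fun i => (be i)%:R / k).
have ZE be : Z be = S *m Hh be *m S^T by rewrite /Hh /Hr whitened_ridge_hessian.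
pose M := Num.max (eta / Num.sqrt m%:R * Num.sqrt kappa * l2norm (w - wstar))
          (2 * L / lambda_min H * l2norm (w - wstar) ^+ 2).
pose wt (be : {ffun 'I_m -> {ffun 'I_n -> bool}}) := w -
  (\sum_t \det (Hh (be t)))^-1 *: (\sum_t \det (Hh (be t)) *: (invmx (Hh (be t)) *m g)).
pose E (be : {ffun 'I_m -> {ffun 'I_n -> bool}}) : bool := l2norm (wt be - wstar) <= M.
have p01 : 0 <= k / n%:R <= 1.
  by rewrite divr_ge0 ?(ltW k0) ?(ltW n0) //= ler_pdivrMr // mul1r.
pose B om : {ffun 'I_m -> {ffun 'I_n -> bool}} := [ffun t => [ffun i => b t i om]].
have hE t om : hessian (Lhat t om) w = Hh (B om t).
  by rewrite hessLhat /Hh; congr Hr; apply/funext => i; rewrite !ffunE.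
have wtE om : wtilde om = wt (B om).
  rewrite /wtilde /wt /a /phat; congr (w - _).
  by congr (_^-1 *: _); apply: eq_bigr => t _; rewrite hE.
(* The event is now a boolean predicate on finite arrays of bits. *)
have setE : [set om | l2norm (wtilde om - wstar) <= M]%R = [set om | E (B om)].
  by apply/seteqP; split => om /=; rewrite /E wtE.
have hZu (be : {ffun 'I_n -> bool}) : S *m Hh be *m S^T \in unitmx.
  exact: (unitmx_congruence Su (posdef_unit (Hhp be))).
(* The deterministic half: a large total determinant and a small sum of errors force the Newton
   bound. *)
have goodE Tq (be : {ffun 'I_m -> {ffun 'I_n -> bool}}) :
    4 * Tq <= m%:R ^+ 2 * (eta ^+ 2 / (4 * m%:R) * dotv q q) ->
    (m%:R / 2 <= \sum_t \det (Z (be t))) &&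
    (dotv (\sum_t weighted_error q (Z (be t))) (\sum_t weighted_error q (Z (be t))) <= Tq) ->
    E be.
  move=> budget /andP[h1 h2].
  pose pt := (\sum_t \det (Hh (be t)))^-1 *:
    (\sum_t \det (Hh (be t)) *: (invmx (Hh (be t)) *m g)).
  have hdet : m%:R / 2 <= \sum_t \det (S *m Hh (be t) *m S^T).
    by under eq_bigr do rewrite -ZE; exact: h1.
  have hY : dotv (\sum_t weighted_error q (S *m Hh (be t) *m S^T))
      (\sum_t weighted_error q (S *m Hh (be t) *m S^T)) <= Tq.
    have -> : \sum_t weighted_error q (S *m Hh (be t) *m S^T) =
        \sum_t weighted_error q (Z (be t)).
      by apply: eq_bigr => t _; rewrite ZE.
    exact: h2.
  have hpt := averaged_newton_direction Su SHS SS (fun t => hZu (be t)) m0 hdet hY budget.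
  have wtD : wt be - wstar = (w - wstar) - pt by rewrite /wt -/pt addrAC.
  rewrite /E wtD /M /kappa.
  exact: (inexact_newton d0 Hpd al0 eps0 aleps eps1 hpt newton_rem).
have [l0 [r0 [rE [r32 [p [p0 pr1 perr pdelta]]]]]] :=
  sample_size_parameters C1 C2 d0 de01 et01 dd.
move: l0 r0 rE r32 pr1 perr pdelta.
set l := ln (d%:R / delta) in Ck *.
set r := Num.sqrt _ => l0 r0 rE r32 pr1 perr pdelta.
have rB : mu * d%:R * d%:R / k <= r ^+ 2.
  by rewrite rE; exact: (sample_size_ratio C0 k0 et0 l0 Ck).
rewrite -/M setE (bernoulli_family_law E p01 dist indep) lee_fin.
set wgt := fun _ _ => _.
have wgt0 t be : 0 <= wgt t be by apply: prodr_ge0 => i _; exact: bern_ge0.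
have wgt1 t : \sum_be wgt t be = 1.
  by apply: (@prodE_weight_sum1 R 'I_n _ (fun _ => bern (k / n%:R))) => i; exact: bern_sum1.
have conc := @determinantal_averaging_concentration R n d W v k (mu * d%:R) r d0 k0 kn
  Wpd W1 vB r0 rB r32 m p q m0 p0 pr1.
have {}conc := le_trans conc pdelta.
have split1 : prodE wgt (fun be => (E be)%:R) + prodE wgt (fun be => (~~ E be)%:R) = 1.
  rewrite -prodED -[RHS](prodE_cst wgt1); congr prodE; apply/funext => be.
  by case: (E be); rewrite ?addr0 ?add0r.
have bad : prodE wgt (fun be => (~~ E be)%:R) <= delta.
  apply: le_trans conc; apply: (prodE_le wgt0) => be.
  apply: indicator_contra; apply: goodE; exact: (error_budget m0 qq0 perr).
by rewrite lerBlDr -[leLHS]split1 lerD2l.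
Qed.
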